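(* Let $c\in\{1,-1,0\}$, let $L^{m}(c)$ be an $m$-dimensional space form of constant sectional curvature $c$, and let $\lambda\ge 0$ be a real constant. Then any totally umbilical $\lambda$-biharmonic hypersurface $\varphi:M^{m}\to L^{m}(c)\times\mathbb{R}$ is minimal, i.e. its mean curvature $H$ vanishes identically.
   Context: $L^m(c)\times\mathbb{R}$ carries the product metric. For a smooth map $\varphi:(M,g)\to (Q,g^Q)$ of Riemannian manifolds, the tension field is $\tau(\varphi)=\mathrm{tr}_g(\nabla d\varphi)$ and the bitension field is $\tau_2(\varphi)=\mathrm{tr}_g(\nabla^\varphi\nabla^\varphi-\nabla^\varphi_{\nabla^M})\tau(\varphi)-\mathrm{tr}_g\widetilde R(d\varphi,\tau(\varphi))d\varphi$, where $\nabla^\varphi$ is the induced connection on $\varphi^{-1}TQ$, $\nabla^M$ the Levi-Civita connection of $M$, and $\widetilde R(X,Y)Z=\widetilde\nabla_X\widetilde\nabla_YZ-\widetilde\nabla_Y\widetilde\nabla_XZ-\widetilde\nabla_{[X,Y]}Z$ the curvature of $Q$. For a real constant $\lambda$, $\varphi$ is called $\lambda$-biharmonic if $\tau_2(\varphi)-\lambda\tau(\varphi)=0$. A $\lambda$-biharmonic hypersurface is a codimension-one isometric immersion that is a $\lambda$-biharmonic map. A hypersurface has unit normal field $\xi$, second fundamental form $B$, shape operator $A$ with $\langle B(X,Y),\xi\rangle=\langle AX,Y\rangle$, and mean curvature $H=\frac1m\mathrm{tr}A$. It is totally umbilical if $\langle B(X,Y),\xi\rangle=H\langle X,Y\rangle$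 for all tangent $X,Y$. *)

(* Defs.v *)
From HB Require Import structures.
From mathcomp Require Import all_boot all_order all_algebra.
From mathcomp Require Import all_classical all_reals all_analysis.

Set Implicit Arguments.
Unset Strict Implicit.
Unset Printing Implicit Defensive.

Import Order.TTheory GRing.Theory Num.Theory.
Import numFieldNormedType.Exports.

Local Open Scope classical_set_scope.
Local Open Scope ring_scope.

(* Riemannian geometry is written in local coordinates. Tangent vectors are
   row vectors of components, so the differential of a map f between
   coordinate spaces sends v to 'D_v f u, and a bilinear form with Gram
   matrix G sends (v, w) to v G w^T. *)

Section Smooth.
Context {R : realType} {n : nat}.

Fixpoint iter_derive (vs : seq 'rV[R]_n) (f : 'rV[R]_n -> R) : 'rV[R]_n -> R :=
  if vs is v :: vs' then fun u => 'D_v (iter_derive vs' f) u else f.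

(* C^oo on an open set U: every iterated directional derivative exists and is
   differentiable at every point of U. *)
Definition smooth_on (U : set 'rV[R]_n) (f : 'rV[R]_n -> R) :=
  forall vs u, U u -> differentiable (iter_derive vs f) u.

Definition bilin (G : 'M[R]_n) (v w : 'rV[R]_n) : R := (v *m G *m w^T) 0 0.

Definition posdef (G : 'M[R]_n) := forall v, v != 0 -> 0 < bilin G v v.

Definition basisv (i : 'I_n) : 'rV[R]_n := delta_mx 0 i.

End Smooth.

Record chart (R : realType) (n : nat) (T : topologicalType) := Chart {
  chart_dom : set T;
  chart_cod : set 'rV[R]_n;
  chart_fun :> T -> 'rV[R]_n;
  chart_inv : 'rV[R]_n -> T;
  chart_dom_open : open chart_dom;
  chart_cod_open : open chart_cod;
  chart_funS : forall p, chart_dom p -> chart_cod (chart_fun p);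
  chart_invS : forall u, chart_cod u -> chart_dom (chart_inv u);
  chart_funK : forall p, chart_dom p -> chart_inv (chart_fun p) = p;
  chart_invK : forall u, chart_cod u -> chart_fun (chart_inv u) = u;
  chart_fun_continuous : forall p, chart_dom p -> {for p, continuous chart_fun};
  chart_inv_continuous : forall u, chart_cod u -> {for u, continuous chart_inv}
}.

Section LocalRep.
Context {R : realType} {m n : nat} {T S : topologicalType}.

Definition local_rep (f : T -> S) (a : chart R m T) (b : chart R n S) :
  'rV[R]_m -> 'rV[R]_n := fun u => b (f (chart_inv a u)).

Definition local_dom (f : T -> S) (a : chart R m T) (b : chart R n S) :
  set 'rV[R]_m := [set u | chart_cod a u /\ chart_dom b (f (chart_inv a u))].

End LocalRep.

Record manifold (R : realType) (n : nat) := Manifold {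
  mcarrier :> topologicalType;
  atlas : Type;
  mchart : atlas -> chart R n mcarrier;
  manifold_hausdorff : hausdorff_space mcarrier;
  manifold_second_countable : @second_countable mcarrier;
  manifold_cover : forall p, exists a, chart_dom (mchart a) p;
  manifold_smooth : forall a b j,
    smooth_on (local_dom id (mchart a) (mchart b))
              (fun u => local_rep id (mchart a) (mchart b) u 0 j)
}.

Record riemannian (R : realType) (n : nat) := Riemannian {
  rmanifold :> manifold R n;
  metric : atlas rmanifold -> 'rV[R]_n -> 'M[R]_n;
  metric_sym : forall a u, chart_cod (mchart a) u -> (metric a u)^T = metric a u;
  metric_posdef : forall a u, chart_cod (mchart a) u -> posdef (metric a u);
  metric_smooth : forall a i j,
    smooth_on (chart_cod (mchart a)) (fun u => metric a u i j);
  metric_compat : forall a b u v w,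
    let psi := local_rep id (mchart a) (mchart b) in
    local_dom id (mchart a) (mchart b) u ->
    bilin (metric a u) v w = bilin (metric b (psi u)) ('D_v psi u) ('D_w psi u)
}.

Section LocalGeometry.
Context {R : realType}.

Section Intrinsic.
Context {n : nat}.
Variable G : 'rV[R]_n -> 'M[R]_n.

(* nabla_(e_i) e_j = \sum_k (christoffel k i j) e_k *)
Definition christoffel (k i j : 'I_n) (u : 'rV[R]_n) : R :=
  2^-1 * \sum_l invmx (G u) k l *
    ('D_(basisv i) (fun x => G x l j) u + 'D_(basisv j) (fun x => G x l i) u
     - 'D_(basisv l) (fun x => G x i j) u).

(* R(e_i, e_j) e_k = \sum_l (curvature_coef l i j k) e_l,
   with R(X,Y)Z = nabla_X nabla_Y Z - nabla_Y nabla_X Z - nabla_[X,Y] Z *)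
Definition curvature_coef (l i j k : 'I_n) (u : 'rV[R]_n) : R :=
  'D_(basisv i) (christoffel l j k) u - 'D_(basisv j) (christoffel l i k) u
  + \sum_p (christoffel l i p u * christoffel p j k u
            - christoffel l j p u * christoffel p i k u).

Definition curvature (u X Y Z : 'rV[R]_n) : 'rV[R]_n :=
  \row_l \sum_i \sum_j \sum_k
    curvature_coef l i j k u * X 0 i * Y 0 j * Z 0 k.

Definition sectional_curvature (u X Y : 'rV[R]_n) : R :=
  bilin (G u) (curvature u X Y Y) X /
  (bilin (G u) X X * bilin (G u) Y Y - bilin (G u) X Y ^+ 2).

End Intrinsic.

Section Maps.
Context {m n : nat}.
Variables (G : 'rV[R]_m -> 'M[R]_m) (H : 'rV[R]_n -> 'M[R]_n).
Variable F : 'rV[R]_m -> 'rV[R]_n.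

(* induced connection on F^-1 TQ: the derivative nabla^F_(e_i) V of a section
   V along F *)
Definition nabla_along (i : 'I_m) (V : 'rV[R]_m -> 'rV[R]_n) :
    'rV[R]_m -> 'rV[R]_n := fun u =>
  'D_(basisv i) V u + \row_c \sum_a \sum_b
     christoffel H c a b (F u) * ('D_(basisv i) F u) 0 a * V u 0 b.

(* (nabla dF)(e_i, e_j) = nabla^F_(e_i) (dF e_j) - dF (nabla_(e_i) e_j) *)
Definition nabla_d (i j : 'I_m) : 'rV[R]_m -> 'rV[R]_n := fun u =>
  nabla_along i (fun x => 'D_(basisv j) F x) u
  - \sum_k christoffel G k i j u *: 'D_(basisv k) F u.

Definition tension : 'rV[R]_m -> 'rV[R]_n := fun u =>
  \sum_i \sum_j invmx (G u) i j *: nabla_d i j u.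

Definition bitension : 'rV[R]_m -> 'rV[R]_n := fun u =>
  \sum_i \sum_j invmx (G u) i j *:
    (nabla_along i (nabla_along j tension) u
     - \sum_k christoffel G k i j u *: nabla_along k tension u)
  - \sum_i \sum_j invmx (G u) i j *:
      curvature H (F u) ('D_(basisv i) F u) (tension u) ('D_(basisv j) F u).

End Maps.
End LocalGeometry.

Section GlobalGeometry.
Context {R : realType} {m n : nat}.

Definition smooth_map (M : manifold R m) (Q : manifold R n) (phi : M -> Q) :=
  continuous phi /\
  forall (a : atlas M) (b : atlas Q) j,
    smooth_on (local_dom phi (mchart a) (mchart b))
              (fun u => local_rep phi (mchart a) (mchart b) u 0 j).

Variables (M : riemannian R m) (Q : riemannian R n) (phi : M -> Q).

Definition isometric_immersion :=
  smooth_map phi /\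
  forall (a : atlas M) (b : atlas Q) u v w,
    let F := local_rep phi (mchart a) (mchart b) in
    local_dom phi (mchart a) (mchart b) u ->
    bilin (metric a u) v w = bilin (metric b (F u)) ('D_v F u) ('D_w F u).

Definition lambda_biharmonic (lambda : R) :=
  smooth_map phi /\
  forall (a : atlas M) (b : atlas Q) u,
    let F := local_rep phi (mchart a) (mchart b) in
    local_dom phi (mchart a) (mchart b) u ->
    bitension (metric a) (metric b) F u
    - lambda *: tension (metric a) (metric b) F u = 0.

Definition totally_geodesic_map :=
  smooth_map phi /\
  forall (a : atlas M) (b : atlas Q) u i j,
    let F := local_rep phi (mchart a) (mchart b) in
    local_dom phi (mchart a) (mchart b) u ->
    nabla_d (metric a) (metric b) F i j u = 0.

(* xi b p is the vector of components, in the chart b of Q, of the value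
   xi(p) in T_(phi p) Q; it is only meaningful when phi p lies in the domain
   of b. *)
Definition vector_field_along (xi : atlas Q -> M -> 'rV[R]_n) :=
  (forall (b b' : atlas Q) p,
     chart_dom (mchart b) (phi p) -> chart_dom (mchart b') (phi p) ->
     xi b' p =
       'D_(xi b p) (local_rep id (mchart b) (mchart b')) (mchart b (phi p))) /\
  (forall (a : atlas M) (b : atlas Q) j,
     smooth_on (local_dom phi (mchart a) (mchart b))
               (fun u => xi b (chart_inv (mchart a) u) 0 j)).

Variable xi : atlas Q -> M -> 'rV[R]_n.

Definition unit_normal_field :=
  vector_field_along xi /\
  forall (a : atlas M) (b : atlas Q) u,
    let F := local_rep phi (mchart a) (mchart b) in
    let N := xi b (chart_inv (mchart a) u) in
    local_dom phi (mchart a) (mchart b) u ->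
    bilin (metric b (F u)) N N = 1 /\
    forall v, bilin (metric b (F u)) ('D_v F u) N = 0.

(* The quantities below are computed in charts a of M and b of Q at the point
   of M with coordinates u; the values do not depend on the choice of charts. *)

(* Gram matrix of <B(e_i, e_j), xi>, where
   B(X,Y) = nabla~_X (dphi Y) - dphi (nabla_X Y) *)
Definition second_fundamental_form (a : atlas M) (b : atlas Q)
    (u : 'rV[R]_m) : 'M[R]_m :=
  let F := local_rep phi (mchart a) (mchart b) in
  \matrix_(i, j) bilin (metric b (F u))
    (nabla_d (metric a) (metric b) F i j u) (xi b (chart_inv (mchart a) u)).

(* X |-> X *m shape_operator is the endomorphism A determined by
   <B(X,Y), xi> = <A X, Y> *)
Definition shape_operator (a : atlas M) (b : atlas Q) (u : 'rV[R]_m) : 'M[R]_m :=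
  second_fundamental_form a b u *m invmx (metric a u).

Definition mean_curvature (a : atlas M) (b : atlas Q) (u : 'rV[R]_m) : R :=
  m%:R^-1 * \tr (shape_operator a b u).

Definition totally_umbilical :=
  forall (a : atlas M) (b : atlas Q) u X Y,
    local_dom phi (mchart a) (mchart b) u ->
    bilin (second_fundamental_form a b u) X Y =
      mean_curvature a b u * bilin (metric a u) X Y.

Definition minimal :=
  forall (a : atlas M) (b : atlas Q) u,
    local_dom phi (mchart a) (mchart b) u -> mean_curvature a b u = 0.

End GlobalGeometry.

Definition constant_sectional_curvature (R : realType) (n : nat) (c : R)
    (L : riemannian R n) :=
  forall (a : atlas L) u X Y, chart_cod (mchart a) u ->
    free [:: X; Y] -> sectional_curvature (metric a) u X Y = c.

Section Precomposition.
Context {R : realType} {n k : nat}.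
Variable l : {linear 'rV[R]_n -> 'rV[R]_k}.
Hypothesis lcont : continuous l.

Lemma quotient_precomp (W : normedModType R) (f : 'rV[R]_k -> W) v u :
  (fun h : R => h^-1 *: ((f \o l \o shift u) (h *: v) - (f \o l) u)) =
  (fun h : R => h^-1 *: ((f \o shift (l u)) (h *: l v) - f (l u))).
Proof. by apply: funext => h /=; rewrite linearP. Qed.

Lemma derive_precomp (W : normedModType R) (f : 'rV[R]_k -> W) v u :
  'D_v (f \o l) u = 'D_(l v) f (l u).
Proof. by rewrite /derive quotient_precomp. Qed.

Lemma derivable_precomp (W : normedModType R) (f : 'rV[R]_k -> W) v u :
  derivable f (l u) (l v) -> derivable (f \o l) u v.
Proof. by rewrite /derivable quotient_precomp. Qed.

Lemma iter_derive_precomp vs (f : 'rV[R]_k -> R) :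
  iter_derive vs (f \o l) = iter_derive (map l vs) f \o l.
Proof.
elim: vs => //= v vs ->; apply/funext => u; exact: derive_precomp.
Qed.

Lemma smooth_on_precomp U (f : 'rV[R]_k -> R) :
  smooth_on U f -> smooth_on (l @^-1` U) (f \o l).
Proof.
move=> sf vs u Uu; rewrite iter_derive_precomp; apply: differentiable_comp.
  by apply: linear_differentiable; exact: lcont.
exact: sf.
Qed.

End Precomposition.

Section SmoothFacts.
Context {R : realType} {n : nat}.

Lemma smooth_onS (U V : set 'rV[R]_n) f :
  smooth_on V f -> U `<=` V -> smooth_on U f.
Proof. by move=> sf UV vs u /UV; exact: sf. Qed.

Lemma smooth_on_cst (U : set 'rV[R]_n) (r : R) : smooth_on U (cst r).
Proof.
have H (vs : seq 'rV[R]_n) : exists s : R, iter_derive vs (cst r) = cst s.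
  elim: vs => [|v vs [s /= ->]]; first by exists r.
  by exists 0; apply/funext => u; rewrite derive_cst.
by move=> vs u _; have [s ->] := H vs; exact: differentiable_cst.
Qed.

Lemma smooth_on_coord (U : set 'rV[R]_n) j : smooth_on U (fun u => u 0 j).
Proof.
have Hd u : differentiable (fun u : 'rV[R]_n => u 0 j) u.
  exact: differentiable_coord.
have D1 v : (fun u => 'D_v (fun u : 'rV[R]_n => u 0 j) u) = cst (v 0 j).
  apply/funext => u; rewrite /derive.
  apply/cvg_lim => //; apply/cvgrPdist_le => e e0; near=> h.
  rewrite /= !mxE addrK /GRing.scale /= mulrA mulVf ?mul1r ?subrr ?normr0 ?ltW//.
  by near: h; exact: nbhs_dnbhs_neq.
have H (vs : seq 'rV[R]_n) : iter_derive vs (fun u : 'rV[R]_n => u 0 j) = (fun u => u 0 j) \/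
   exists s : R, iter_derive vs (fun u : 'rV[R]_n => u 0 j) = cst s.
  elim: vs => [|v vs [/= ->|[s /= ->]]]; first by left.
    by right; exists (v 0 j).
  by right; exists 0; apply/funext => u; rewrite derive_cst.
move=> vs u _; have [->|[s ->]] := H vs; [exact: Hd|exact: differentiable_cst].
Unshelve. all: by end_near. Qed.

End SmoothFacts.

Section Products.
Context {R : realType}.

Lemma hausdorff_prod (S T : topologicalType) :
  hausdorff_space S -> hausdorff_space T -> hausdorff_space (S * T)%type.
Proof.
move=> hS hT [p1 p2] [q1 q2] pq; congr pair.
  apply: hS => A B Ap Bq.
  have [| |[x y] [/= [Ax _] [Bx _]]] := pq (A `*` setT) (B `*` setT).
  - by exists (A, setT) => //; split => //=; exact: filterT.
  - by exists (B, setT) => //; split => //=; exact: filterT.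
  by exists x.
apply: hT => A B Ap Bq.
have [| |[x y] [/= [_ Ay] [_ By]]] := pq (setT `*` A) (setT `*` B).
- by exists (setT, A) => //; split => //=; exact: filterT.
- by exists (setT, B) => //; split => //=; exact: filterT.
by exists y.
Qed.

Lemma open_setX (S T : topologicalType) (A : set S) (B : set T) :
  open A -> open B -> open (A `*` B).
Proof.
move=> oA oB; rewrite openE => -[x y] [/= Ax By].
by exists (A, B) => //; split; exact: open_nbhs_nbhs.
Qed.

Lemma second_countable_prod (S T : topologicalType) :
  @second_countable S -> @second_countable T ->
  @second_countable (S * T)%type.
Proof.
move=> [B cB [oB bB]] [C cC [oC bC]].
exists [set D.1 `*` D.2 | D in B `*` C].
  by apply: sub_countable (card_image_le _ _) _; exact: countableX.
split=> [_ [[U V] [/= BU CV] <-]|[x y] D [[U V]] /= [xU yV] UVD].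
  by apply: open_setX; [exact: oB|exact: oC].
have [U' [BU' xU'] sU] := bB x U xU.
have [V' [CV' yV'] sV] := bC y V yV.
exists (U' `*` V'); first by split=> //; exists (U', V').
by move=> [a b] [/= /sU ? /sV ?]; exact: UVD.
Qed.

Lemma second_countable_real : @second_countable R.
Proof.
exists [set `]ratr q.1, ratr q.2[%classic | q in [set: rat * rat]].
  apply: sub_countable (card_image_le _ _) _; exact: countableP.
split=> [_ [q _ <-]|x A /nbhs_ballP[e /= e0 eA]]; first exact: interval_open.
have [q /[!in_itv]/= /andP[q1 q2]] : exists q, ratr q \in `]x - e, x[.
  by apply: rat_in_itvoo; rewrite ltrBlDr ltrDl.
have [r /[!in_itv]/= /andP[r1 r2]] : exists q, ratr q \in `]x, x + e[.
  by apply: rat_in_itvoo; rewrite ltrDl.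
exists `]ratr q, ratr r[%classic.
  by split; [exists (q, r)|rewrite /= in_itv /= q2 r1].
move=> y; rewrite /= in_itv /= => /andP[qy yr]; apply: eA.
by rewrite ball_itv /= in_itv /= (lt_trans q1)//= (lt_trans yr).
Qed.

Lemma cvg_rV (T : topologicalType) n (f : T -> 'rV[R]_n) p :
  (forall j, {for p, continuous (fun x => f x 0 j)}) -> {for p, continuous f}.
Proof.
move=> cf A [P nP sP].
have H : \forall x \near p, forall j, P 0 j (f x 0 j).
  by apply: filter_forall => j; exact: cf (nP 0 j).
by apply: filterS H => x Px; apply: sP => i j; rewrite ord1.
Qed.

Section ChartProduct.
Context {m n : nat} {S T : topologicalType}.
Variables (a : chart R m S) (b : chart R n T).

Definition prod_chart_dom : set (S * T) := chart_dom a `*` chart_dom b.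
Definition prod_chart_cod : set 'rV[R]_(m + n) :=
  [set u | chart_cod a (lsubmx u) /\ chart_cod b (rsubmx u)].
Definition prod_chart_fun (p : S * T) : 'rV[R]_(m + n) := row_mx (a p.1) (b p.2).
Definition prod_chart_inv (u : 'rV[R]_(m + n)) : S * T :=
  (chart_inv a (lsubmx u), chart_inv b (rsubmx u)).

Lemma prod_chart_dom_open : open prod_chart_dom.
Proof. by apply: open_setX; exact: chart_dom_open. Qed.

Lemma prod_chart_cod_open : open prod_chart_cod.
Proof.
rewrite /prod_chart_cod; apply: openI.
  apply: (@open_comp _ _ lsubmx (chart_cod a)); last exact: chart_cod_open.
  by move=> ? _; exact: continuous_lsubmx.
apply: (@open_comp _ _ rsubmx (chart_cod b)); last exact: chart_cod_open.
by move=> ? _; exact: continuous_rsubmx.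
Qed.

Lemma prod_chart_funS p : prod_chart_dom p -> prod_chart_cod (prod_chart_fun p).
Proof.
by move=> [? ?]; split; rewrite /prod_chart_fun ?row_mxKl ?row_mxKr;
  exact: chart_funS.
Qed.

Lemma prod_chart_invS u : prod_chart_cod u -> prod_chart_dom (prod_chart_inv u).
Proof. by move=> [? ?]; split; exact: chart_invS. Qed.

Lemma prod_chart_funK p :
  prod_chart_dom p -> prod_chart_inv (prod_chart_fun p) = p.
Proof.
case: p => x y [? ?].
by rewrite /prod_chart_inv /prod_chart_fun row_mxKl row_mxKr !chart_funK.
Qed.

Lemma prod_chart_invK u :
  prod_chart_cod u -> prod_chart_fun (prod_chart_inv u) = u.
Proof. by move=> [? ?]; rewrite /prod_chart_fun /= !chart_invK ?hsubmxK. Qed.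

Lemma prod_chart_fun_cont p :
  prod_chart_dom p -> {for p, continuous prod_chart_fun}.
Proof.
move=> [d1 d2]; apply: cvg_rV => j; case: (split_ordP j) => k ->.
  rewrite (_ : (fun x => _) = (fun u : 'rV[R]_m => u 0 k) \o (a \o fst)); last first.
    by apply/funext => x /=; rewrite /prod_chart_fun row_mxEl.
  apply: continuous_comp; last exact: coord_continuous.
  apply: continuous_comp; [exact: cvg_fst|exact: chart_fun_continuous].
rewrite (_ : (fun x => _) = (fun u : 'rV[R]_n => u 0 k) \o (b \o snd)); last first.
  by apply/funext => x /=; rewrite /prod_chart_fun row_mxEr.
apply: continuous_comp; last exact: coord_continuous.
apply: continuous_comp; [exact: cvg_snd|exact: chart_fun_continuous].
Qed.

Lemma prod_chart_inv_cont u :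
  prod_chart_cod u -> {for u, continuous prod_chart_inv}.
Proof.
move=> [c1 c2].
have h1 : {for u, continuous (chart_inv a \o lsubmx)}.
  apply: continuous_comp; first exact: continuous_lsubmx.
  exact: chart_inv_continuous.
have h2 : {for u, continuous (chart_inv b \o rsubmx)}.
  apply: continuous_comp; first exact: continuous_rsubmx.
  exact: chart_inv_continuous.
exact: (cvg_pair h1 h2).
Qed.

Definition prod_chart : chart R (m + n) (S * T)%type :=
  Chart prod_chart_dom_open prod_chart_cod_open prod_chart_funS
    prod_chart_invS prod_chart_funK prod_chart_invK
    prod_chart_fun_cont prod_chart_inv_cont.

End ChartProduct.

Lemma derive_row_mx m n m' n' (f : 'rV[R]_m -> 'rV[R]_m')
    (g : 'rV[R]_n -> 'rV[R]_n') (u v : 'rV[R]_(m + n)) :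
  derivable f (lsubmx u) (lsubmx v) -> derivable g (rsubmx u) (rsubmx v) ->
  'D_v (fun u => row_mx (f (lsubmx u)) (g (rsubmx u))) u =
  row_mx ('D_(lsubmx v) f (lsubmx u)) ('D_(rsubmx v) g (rsubmx u)).
Proof.
move=> df dg.
have df' : derivable (f \o lsubmx) u v by exact: derivable_precomp.
have dg' : derivable (g \o rsubmx) u v by exact: derivable_precomp.
have El k : (fun u => row_mx (f (lsubmx u)) (g (rsubmx u)) 0 (lshift n' k)) =
    (fun u => (f \o lsubmx) u 0 k).
  by apply: funext => x; rewrite row_mxEl.
have Er k : (fun u => row_mx (f (lsubmx u)) (g (rsubmx u)) 0 (rshift m' k)) =
    (fun u => (g \o rsubmx) u 0 k).
  by apply: funext => x; rewrite row_mxEr.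
rewrite derive_mx; last first.
  apply/derivable_mxP => i j; rewrite ord1; case: (split_ordP j) => k ->.
    by rewrite El; move/derivable_mxP : df'; exact.
  by rewrite Er; move/derivable_mxP : dg'; exact.
rewrite -[in RHS]derive_precomp -[in RHS]derive_precomp (derive_mx df') (derive_mx dg').
apply/rowP => j; rewrite mxE; case: (split_ordP j) => k ->.
  by rewrite row_mxEl mxE El.
by rewrite row_mxEr mxE Er.
Qed.

Lemma smooth_on_derivable m n (U : set 'rV[R]_m) (f : 'rV[R]_m -> 'rV[R]_n) u v :
  (forall j, smooth_on U (fun x => f x 0 j)) -> U u -> derivable f u v.
Proof.
move=> sf Uu; apply/derivable_mxP => i j; rewrite ord1.
by apply: diff_derivable; exact: (sf j [::]).
Qed.

Lemma bilin_block m n (A : 'M[R]_m) (B : 'M[R]_n) v w :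
  bilin (block_mx A 0 0 B) v w =
  bilin A (lsubmx v) (lsubmx w) + bilin B (rsubmx v) (rsubmx w).
Proof.
rewrite /bilin -{1}[v]hsubmxK -{1}[w]hsubmxK mul_row_block !mulmx0 addr0 add0r.
by rewrite tr_row_mx mul_row_col mxE.
Qed.

Section ManifoldProduct.
Context {m n : nat}.
Variables (M : manifold R m) (N : manifold R n).

Definition prod_mchart (ab : atlas M * atlas N) : chart R (m + n) (M * N)%type :=
  prod_chart (mchart ab.1) (mchart ab.2).

Lemma prod_manifold_cover (p : (M * N)%type) : exists ab, chart_dom (prod_mchart ab) p.
Proof.
have [a ap] := manifold_cover p.1; have [b bp] := manifold_cover p.2.
by exists (a, b); split.
Qed.

Lemma prod_manifold_smooth ab cd j :
  smooth_on (local_dom id (prod_mchart ab) (prod_mchart cd))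
    (fun u => local_rep id (prod_mchart ab) (prod_mchart cd) u 0 j).
Proof.
case: (split_ordP j) => k ->.
  rewrite (_ : (fun u => _) =
    (fun u => local_rep id (mchart ab.1) (mchart cd.1) u 0 k) \o lsubmx).
    have h := smooth_on_precomp (@continuous_lsubmx R 1 m n) (@manifold_smooth _ _ M ab.1 cd.1 k).
    apply: (smooth_onS h).
    by move=> u [[? _] [? _]]; split.
  by apply: funext => u; rewrite /local_rep /= row_mxEl.
rewrite (_ : (fun u => _) =
  (fun u => local_rep id (mchart ab.2) (mchart cd.2) u 0 k) \o rsubmx).
  have h := smooth_on_precomp (@continuous_rsubmx R 1 m n) (@manifold_smooth _ _ N ab.2 cd.2 k).
    apply: (smooth_onS h).
    by move=> u [[_ ?] [_ ?]]; split.
by apply: funext => u; rewrite /local_rep /= row_mxEr.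
Qed.

Definition prod_manifold : manifold R (m + n) :=
  Manifold (hausdorff_prod (@manifold_hausdorff _ _ M) (@manifold_hausdorff _ _ N))
    (second_countable_prod (@manifold_second_countable _ _ M)
       (@manifold_second_countable _ _ N)) prod_manifold_cover prod_manifold_smooth.

End ManifoldProduct.

Section RiemannianProduct.
Context {m n : nat}.
Variables (M : riemannian R m) (N : riemannian R n).

Definition prod_metric (ab : atlas (prod_manifold M N)) (u : 'rV[R]_(m + n)) :
    'M[R]_(m + n) :=
  block_mx (metric ab.1 (lsubmx u)) 0 0 (metric ab.2 (rsubmx u)).

Lemma prod_metric_sym ab u :
  chart_cod (mchart ab) u -> (prod_metric ab u)^T = prod_metric ab u.
Proof.
by move=> [? ?]; rewrite /prod_metric tr_block_mx !trmx0 !metric_sym.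
Qed.

Lemma prod_metric_pos ab u : chart_cod (mchart ab) u -> posdef (prod_metric ab u).
Proof.
move=> [c1 c2] v v0; rewrite bilin_block.
have [l0|l0] := eqVneq (lsubmx v) 0; last first.
  apply: ltr_pwDl; first exact: metric_posdef.
  have [->|r0] := eqVneq (rsubmx v) 0; first by rewrite /bilin !mul0mx mxE.
  by apply/ltW; exact: metric_posdef.
rewrite l0 {1}/bilin !mul0mx mxE add0r; apply: metric_posdef => //.
apply: contraNneq v0 => r0.
by rewrite -[v]hsubmxK l0 r0 row_mx0.
Qed.

Lemma prod_metric_smooth ab i j :
  smooth_on (chart_cod (mchart ab)) (fun u => prod_metric ab u i j).
Proof.
have [] := (split_ordP i, split_ordP j).
move=> [k ->|k ->] [l ->|l ->].
- rewrite (_ : (fun u => _) = (fun u => metric ab.1 u k l) \o lsubmx).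
    have h := smooth_on_precomp (@continuous_lsubmx R 1 m n) (@metric_smooth _ _ M ab.1 k l).
    apply: (smooth_onS h).
    by move=> u [].
  by apply: funext => u; rewrite /prod_metric block_mxEul.
- rewrite (_ : (fun u => _) = cst 0); first exact: smooth_on_cst.
  by apply: funext => u; rewrite /prod_metric block_mxEur mxE.
- rewrite (_ : (fun u => _) = cst 0); first exact: smooth_on_cst.
  by apply: funext => u; rewrite /prod_metric block_mxEdl mxE.
- rewrite (_ : (fun u => _) = (fun u => metric ab.2 u k l) \o rsubmx).
    have h := smooth_on_precomp (@continuous_rsubmx R 1 m n) (@metric_smooth _ _ N ab.2 k l).
    apply: (smooth_onS h).
    by move=> u [].
  by apply: funext => u; rewrite /prod_metric block_mxEdr.
Qed.

Lemma prod_metric_compat ab cd u v w :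
  let psi := local_rep id (mchart ab) (mchart cd) in
  local_dom id (mchart ab) (mchart cd) u ->
  bilin (prod_metric ab u) v w =
  bilin (prod_metric cd (psi u)) ('D_v psi u) ('D_w psi u).
Proof.
move=> psi [[c1 c2] [d1 d2]].
have D x : 'D_x psi u = row_mx
    ('D_(lsubmx x) (local_rep id (mchart ab.1) (mchart cd.1)) (lsubmx u))
    ('D_(rsubmx x) (local_rep id (mchart ab.2) (mchart cd.2)) (rsubmx u)).
  apply: derive_row_mx.
    apply: (@smooth_on_derivable _ _ (local_dom id (mchart ab.1) (mchart cd.1))) => //.
    exact: manifold_smooth.
  apply: (@smooth_on_derivable _ _ (local_dom id (mchart ab.2) (mchart cd.2))) => //.
    exact: manifold_smooth.
rewrite !bilin_block !D !row_mxKl !row_mxKr.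
by congr (_ + _); exact: metric_compat.
Qed.

Definition riemannian_prod : riemannian R (m + n) :=
  @Riemannian R (m + n) (prod_manifold M N) prod_metric prod_metric_sym
    prod_metric_pos prod_metric_smooth prod_metric_compat.

End RiemannianProduct.

Section RealLine.

Definition line_fun (t : R) : 'rV[R]_1 := const_mx t.
Definition line_inv (u : 'rV[R]_1) : R := u 0 0.

Lemma line_funS t : setT t -> setT (line_fun t). Proof. by []. Qed.
Lemma line_invS u : setT u -> setT (line_inv u). Proof. by []. Qed.
Lemma line_funK t : setT t -> line_inv (line_fun t) = t.
Proof. by rewrite /line_inv mxE. Qed.
Lemma line_invK u : setT u -> line_fun (line_inv u) = u.
Proof. by move=> _; apply/rowP => i; rewrite mxE ord1. Qed.
Lemma line_fun_cont t : setT t -> {for t, continuous line_fun}.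
Proof.
move=> _; apply: cvg_rV => j.
by rewrite (_ : (fun x => _) = id) //; apply: funext => x; rewrite mxE.
Qed.
Lemma line_inv_cont u : setT u -> {for u, continuous line_inv}.
Proof. by move=> _; exact: coord_continuous. Qed.

Definition line_chart : chart R 1 R :=
  Chart openT openT line_funS line_invS line_funK line_invK
    line_fun_cont line_inv_cont.

Lemma line_cover (p : R) : exists a : unit, chart_dom line_chart p.
Proof. by exists tt. Qed.

Lemma line_repE : local_rep id line_chart line_chart = id.
Proof. by apply: funext => u; rewrite /local_rep /= line_invK. Qed.

Lemma line_smooth (a b : unit) j : smooth_on (local_dom id line_chart line_chart)
  (fun u => local_rep id line_chart line_chart u 0 j).
Proof. by rewrite line_repE; exact: smooth_on_coord. Qed.

Definition line_manifold : manifold R 1 :=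
  Manifold (@Rhausdorff R) second_countable_real line_cover line_smooth.

Definition line_metric (a : atlas line_manifold) (u : 'rV[R]_1) : 'M[R]_1 := 1%:M.

Lemma line_metric_sym a u :
  chart_cod (mchart a) u -> (line_metric a u)^T = line_metric a u.
Proof. by rewrite /line_metric trmx1. Qed.

Lemma line_metric_pos a u : chart_cod (mchart a) u -> posdef (line_metric a u).
Proof.
move=> _ v v0; rewrite /bilin mulmx1 mxE big_ord1 mxE.
rewrite -expr2 exprn_even_gt0 //=; apply: contraNneq v0 => v00.
by apply/eqP/rowP => i; rewrite ord1 mxE.
Qed.

Lemma line_metric_smooth a i j :
  smooth_on (chart_cod (mchart a)) (fun u => line_metric a u i j).
Proof. exact: smooth_on_cst. Qed.

Lemma line_metric_compat a b u v w :
  let psi := local_rep id (mchart a) (mchart b) in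
  local_dom id (mchart a) (mchart b) u ->
  bilin (line_metric a u) v w =
  bilin (line_metric b (psi u)) ('D_v psi u) ('D_w psi u).
Proof. by move=> psi _; rewrite /psi /= line_repE !derive_id. Qed.

Definition real_line : riemannian R 1 :=
  @Riemannian R 1 line_manifold line_metric line_metric_sym line_metric_pos
    line_metric_smooth line_metric_compat.

End RealLine.
End Products.

(* Completeness: every initial velocity v at p, given by components in a chart
   b, is the velocity at time 0 of a geodesic defined for all times. A geodesic
   is a map gamma : R -> L with nabla (d gamma) = 0, i.e.
   nabla_(gamma') gamma' = 0. *)
Definition geodesically_complete (R : realType) (n : nat) (L : riemannian R n) :=
  forall (b : atlas L) (p : L) (v : 'rV[R]_n), chart_dom (mchart b) p ->
    exists gamma : real_line -> L,
      [/\ totally_geodesic_map gamma, gamma 0 = p &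
          derive1 (fun t : R => mchart b (gamma t)) 0 = v].

(* Simple connectedness is not required, so quotients of the model spaces S^n,
   R^n, H^n are included. When n = 1 the curvature condition is vacuous. *)
Definition space_form (R : realType) (n : nat) (c : R) (L : riemannian R n) :=
  [/\ connected [set: L], geodesically_complete L &
      constant_sectional_curvature c L].

(* Main.v *)
Require Import Defs.
From mathcomp Require Import all_boot all_order all_algebra.
From mathcomp Require Import all_classical all_reals all_analysis.
From mathcomp Require Import ring lra.

Set Implicit Arguments.
Unset Strict Implicit.
Unset Printing Implicit Defensive.

Import Order.TTheory GRing.Theory Num.Theory.
Import numFieldNormedType.Exports.

Local Open Scope classical_set_scope.
Local Open Scope ring_scope.

(* Let h be the height function on M (so grad h is the tangential part T of
   d/dt), C = <xi, d/dt> and q = (m - 1) c. Umbilicity and the parallelism of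
   d/dt give Hess h = H C g, grad C = - H T and |T|^2 = 1 - C^2, and the tension
   field is m H xi. Where H <> 0, the tangential part of the lambda-biharmonic
   equation reads 3 grad H = - q C T; substituting this into the normal part
   yields the first integral
     4 q - q (4 + m) C^2 - 3 m H^2 = 3 lambda.
   Differentiating it gives q C T = 0. If q = 0 the first integral says
   - m H^2 = lambda, which is absurd. Otherwise C T = 0, whose derivative is
   h_i h_j = C^2 g_ij; multiplying by C gives C = 0, hence T = 0, against
   C^2 + |T|^2 = 1. No Codazzi equation is needed, so that m = 1 and m = 4 are
   not special. *)

(** The computation runs in an arbitrary coordinate frame: contractions with [invmx (g u)] replace
    sums over an orthonormal frame, and a vector identity is proved by pairing it with the frame [E]
    and the normal [xi]. Two obstacles shape what precedes it. A derivative ['D_v] is a limit that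
    exists formally for every function, so each rule has to be backed by smoothness on an open set.
    And the hypothesis on L gives sectional curvatures only, while the bitension field contains the
    full tensor; polarization recovers it, but needs all curvature symmetries, one of which rests on
    the symmetry of second derivatives. Origin of the constants: in the tangential part, 3 = 1 + 2,
    with 1 from differentiating [xi] in the term grad H times [xi] and 2 from differentiating H^2 in
    the term H^2 times [E j]. In q, m - 1 is the trace of the metric minus the trace of one rank-one
    term. In the first integral, 4 = 3 + 1: the curvature term, multiplied by 3, plus the gradient
    part of the Hessian of H. *)

Section DifferentialCalculus.
Context {R : realType}.

Lemma near_open n (U : set 'rV[R]_n) u : open U -> U u -> \forall x \near u, U x.
Proof. by move=> oU Uu; exact: open_nbhs_nbhs. Qed.

Lemma derive_eq_on n (W : normedModType R) (U : set 'rV[R]_n)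
    (f g : 'rV[R]_n -> W) u v :
  open U -> (forall x, U x -> f x = g x) -> U u -> 'D_v f u = 'D_v g u.
Proof.
move=> oU fg Uu; apply: near_eq_derive.
by apply: filterS (near_open oU Uu) => x Ux; exact: fg.
Qed.

(** The little-o expansion of [f] at [u] involves only values near [u], so it is also an expansion
    of [g]; uniqueness of the differential then identifies its linear part with that of [g]. *)
Lemma near_eq_differentiable (V W : normedModType R) (f g : V -> W) u :
  (\forall x \near u, f x = g x) -> differentiable f u -> differentiable g u.
Proof.
move=> fg /diff_locallyP[cd ed].
have eg : g \o shift u = cst (g u) + 'd f u +o_ 0 id.
  apply/eqaddoP => e e0; move/eqaddoP : ed => /(_ e e0).
  move: (fg); rewrite (near_shift 0) => /=.
  apply: filterS2 => h; rewrite subr0 => fgh.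
  by rewrite /= !fctE /= fgh (nbhs_singleton fg).
by apply/diff_locallyP; rewrite (diff_unique cd eg).
Qed.

Lemma differentiable_eq_on n (W : normedModType R) (U : set 'rV[R]_n)
    (f g : 'rV[R]_n -> W) u :
  open U -> (forall x, U x -> f x = g x) -> U u ->
  differentiable f u -> differentiable g u.
Proof.
move=> oU fg Uu; apply: near_eq_differentiable.
by apply: filterS (near_open oU Uu) => x Ux; exact: fg.
Qed.

Lemma differentiable_rV n (V : normedModType R) (f : V -> 'rV[R]_n) u :
  (forall j, differentiable (fun x => f x 0 j) u) -> differentiable f u.
Proof.
move=> df.
have -> : f = \sum_j (fun x => f x 0 j *: (delta_mx 0 j : 'rV[R]_n)).
  by apply/funext => x; rewrite fct_sumE [LHS]row_sum_delta.
by apply: differentiable_sum => j; exact: differentiableZl.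
Qed.

Lemma derive_rowE m n (f : 'rV[R]_m -> 'rV[R]_n) u v j :
  differentiable f u -> ('D_v f u) 0 j = 'D_v (fun x => f x 0 j) u.
Proof. by move=> df; rewrite derive_mx ?mxE//; exact: diff_derivable. Qed.

Lemma derive_comp (V V' W : normedModType R) (f : V' -> W)
    (g : V -> V') u v :
  differentiable g u -> differentiable f (g u) ->
  'D_v (f \o g) u = 'D_('D_v g u) f (g u).
Proof.
move=> dg df; rewrite (deriveE _ (differentiable_comp dg df)).
by rewrite diff_comp// !deriveE.
Qed.

Lemma derive_basis n (W : normedModType R) (f : 'rV[R]_n -> W) u v :
  differentiable f u -> 'D_v f u = \sum_i v 0 i *: 'D_(basisv i) f u.
Proof.
move=> df; rewrite deriveE// [in LHS](row_sum_delta v) linear_sum.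
by apply: eq_bigr => i _; rewrite linearZ deriveE.
Qed.

End DifferentialCalculus.

(** * Smooth functions *)

Section SmoothClosure.
Context {R : realType} {n : nat}.
Implicit Types (U : set 'rV[R]_n) (f g : 'rV[R]_n -> R).

(** Order-by-order form of smoothness. [iter_derive] adds derivatives on the outside, whereas here
    the innermost one is peeled off, so that the Leibniz and chain rules become inductions on [k]
    over all functions at once. *)
Fixpoint diff_order k U f :=
  (forall u, U u -> differentiable f u) /\
  if k is k'.+1 then forall v, diff_order k' U ('D_v f) else True.

Lemma smooth_onP U f : smooth_on U f <-> forall k, diff_order k U f.
Proof.
split=> [sf k|sf vs].
  suff H vs : diff_order k U (iter_derive vs f) by exact: (H [::]).
  elim: k vs => [|k IH] vs; split=> //; try exact: sf.
  by move=> v; exact: (IH (v :: vs)).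
have H : forall k, diff_order k U (iter_derive vs f).
  by elim: vs => [//|v vs IH] k; exact: (IH k.+1).2.
by case: (H 0%N).
Qed.

Lemma diff_orderW k U f : diff_order k.+1 U f -> diff_order k U f.
Proof.
elim: k f => [|k IH] f; first by case.
by case=> df Df; split=> // v; apply: IH; exact: Df.
Qed.

Lemma diff_order_eq k U f g : open U -> (forall x, U x -> f x = g x) ->
  diff_order k U f -> diff_order k U g.
Proof.
move=> oU; elim: k f g => [|k IH] f g fg [df Df]; split=> //;
  try by move=> u Uu; exact: (differentiable_eq_on oU fg Uu (df u Uu)).
move=> v; apply: IH (Df v) => x Ux; exact: derive_eq_on Ux.
Qed.

Lemma diff_order_cst k U (c : R) : diff_order k U (cst c).
Proof. by have /smooth_onP := smooth_on_cst (U := U) c. Qed.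

Variable U : set 'rV[R]_n.
Hypothesis oU : open U.

Lemma diff_orderD k f g : diff_order k U f -> diff_order k U g ->
  diff_order k U (fun x => f x + g x).
Proof.
elim: k f g => [|k IH] f g [df Df] [dg Dg]; split=> //;
  try by move=> u Uu; apply: differentiableD; [exact: df|exact: dg].
move=> v; apply: diff_order_eq (IH _ _ (Df v) (Dg v)) => // x Ux.
by rewrite -deriveD//; apply: diff_derivable; [exact: df|exact: dg].
Qed.

Lemma diff_orderM k f g : diff_order k U f -> diff_order k U g ->
  diff_order k U (fun x => f x * g x).
Proof.
elim: k f g => [|k IH] f g sf sg; have [df Df] := sf; have [dg Dg] := sg; split=> //;
  try by move=> u Uu; apply: differentiableM; [exact: df|exact: dg].
move=> v.
(* Each Leibniz term keeps one undifferentiated factor; it is smooth to order [k.+1] and enters the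
   induction at order [k], hence [diff_orderW]. *)
apply: diff_order_eq (diff_orderD (IH _ _ (diff_orderW sf) (Dg v))
                       (IH _ _ (diff_orderW sg) (Df v))) => // x Ux.
by rewrite [RHS]deriveM//; apply: diff_derivable; [exact: df|exact: dg].
Qed.

Lemma diff_orderV k f : (forall x, U x -> f x != 0) -> diff_order k U f ->
  diff_order k U (fun x => (f x)^-1).
Proof.
move=> f0; elim: k => [|k IH] sf; have [df Df] := sf; split=> //;
  try by move=> u Uu; apply: differentiableV; [exact: df|exact: f0].
move=> v; have iV := IH (diff_orderW sf).
(* The derivative of 1/f contains 1/f again, but one order less of it is required: [iV] provides
   exactly that. *)
apply: (@diff_order_eq _ _ (fun x => -1 * ((f x)^-1 * (f x)^-1) * 'D_v f x)) => //.
  move=> x Ux; rewrite deriveV; [|exact: f0|apply: diff_derivable; exact: df].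
  by rewrite mulN1r -expr2 exprVn.
apply: diff_orderM (Df v); apply: diff_orderM; last exact: diff_orderM.
exact: (diff_order_cst k U (-1)).
Qed.

Lemma smooth_onD f g : smooth_on U f -> smooth_on U g ->
  smooth_on U (fun x => f x + g x).
Proof.
by move=> /smooth_onP sf /smooth_onP sg; apply/smooth_onP => k; exact: diff_orderD.
Qed.

Lemma smooth_onM f g : smooth_on U f -> smooth_on U g ->
  smooth_on U (fun x => f x * g x).
Proof.
by move=> /smooth_onP sf /smooth_onP sg; apply/smooth_onP => k; exact: diff_orderM.
Qed.

Lemma smooth_onV f : (forall x, U x -> f x != 0) -> smooth_on U f ->
  smooth_on U (fun x => (f x)^-1).
Proof.
by move=> f0 /smooth_onP sf; apply/smooth_onP => k; exact: diff_orderV.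
Qed.

Lemma smooth_on_eq f g : (forall x, U x -> f x = g x) ->
  smooth_on U f -> smooth_on U g.
Proof.
by move=> fg /smooth_onP sf; apply/smooth_onP => k; exact: diff_order_eq (sf k).
Qed.

Lemma smooth_onN f : smooth_on U f -> smooth_on U (fun x => - f x).
Proof.
move=> sf; apply: (@smooth_on_eq (fun x => -1 * f x)) => [x _|].
  by rewrite mulN1r.
by apply: smooth_onM => //; exact: smooth_on_cst.
Qed.

Lemma smooth_on_sum (I : Type) (r : seq I) (P : pred I) (F : I -> 'rV[R]_n -> R) :
  (forall i, smooth_on U (F i)) -> smooth_on U (fun x => \sum_(i <- r | P i) F i x).
Proof.
move=> sF; elim: r => [|i r IH].
  by apply: (@smooth_on_eq (cst 0)) => [x _|]; rewrite ?big_nil//; exact: smooth_on_cst.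
case Pi : (P i).
  apply: (@smooth_on_eq (fun x => F i x + \sum_(i <- r | P i) F i x)) => [x _|].
    by rewrite big_cons Pi.
  by apply: smooth_onD.
by apply: smooth_on_eq IH => x _; rewrite big_cons Pi.
Qed.

Lemma smooth_on_prod (I : Type) (r : seq I) (F : I -> 'rV[R]_n -> R) :
  (forall i, smooth_on U (F i)) -> smooth_on U (fun x => \prod_(i <- r) F i x).
Proof.
move=> sF; elim: r => [|i r IH].
  by apply: (@smooth_on_eq (cst 1)) => [x _|]; rewrite ?big_nil//; exact: smooth_on_cst.
apply: (@smooth_on_eq (fun x => F i x * \prod_(i <- r) F i x)) => [x _|].
  by rewrite big_cons.
by apply: smooth_onM.
Qed.

Lemma smooth_on_derive f v : smooth_on U f -> smooth_on U ('D_v f).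
Proof.
by move=> /smooth_onP sf; apply/smooth_onP => k; exact: (sf k.+1).2.
Qed.

Lemma smooth_on_det p (A : 'rV[R]_n -> 'M[R]_p) :
  (forall i j, smooth_on U (fun x => A x i j)) -> smooth_on U (fun x => \det (A x)).
Proof.
move=> sA; apply: smooth_on_sum => s; apply: smooth_onM.
  exact: smooth_on_cst.
by apply: smooth_on_prod => i; exact: sA.
Qed.

(** Cramer's rule: each entry of the inverse is a polynomial in the entries divided by the
    determinant. *)
Lemma smooth_on_invmx p (A : 'rV[R]_n -> 'M[R]_p) i j :
  (forall x, U x -> A x \in unitmx) ->
  (forall i j, smooth_on U (fun x => A x i j)) ->
  smooth_on U (fun x => invmx (A x) i j).
Proof.
move=> uA sA.
apply: (@smooth_on_eq (fun x => (\det (A x))^-1 * ((-1) ^+ (j + i) *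
    \det (row' j (col' i (A x)))))) => [x Ux|].
  by rewrite /invmx uA// !mxE.
apply: smooth_onM.
  apply: smooth_onV; last exact: smooth_on_det.
  by move=> x /uA; rewrite unitmxE unitfE.
apply: smooth_onM; first exact: smooth_on_cst.
apply: smooth_on_det => k l.
by apply: (@smooth_on_eq (fun x => A x (lift j k) (lift i l))) => // x _; rewrite !mxE.
Qed.

End SmoothClosure.

(** * Vector-valued smooth maps and the chain rule *)

Section SmoothMaps.
Context {R : realType} {m n : nat}.

Definition vsmooth_on (U : set 'rV[R]_m) (f : 'rV[R]_m -> 'rV[R]_n) :=
  forall j, smooth_on U (fun u => f u 0 j).

Lemma smooth_on_differentiable (U : set 'rV[R]_m) (f : 'rV[R]_m -> R) u :
  smooth_on U f -> U u -> differentiable f u.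
Proof. by move=> sf Uu; exact: (sf [::]). Qed.

Lemma vsmooth_differentiable U f u :
  vsmooth_on U f -> U u -> differentiable f u.
Proof.
move=> sf Uu; apply: differentiable_rV => j; exact: smooth_on_differentiable Uu.
Qed.

Lemma vsmooth_eq U f g : open U -> (forall x, U x -> f x = g x) ->
  vsmooth_on U f -> vsmooth_on U g.
Proof. by move=> oU fg sf j; apply: smooth_on_eq (sf j) => // x Ux; rewrite fg. Qed.

Lemma vsmooth_derive U f v : open U -> vsmooth_on U f -> vsmooth_on U ('D_v f).
Proof.
move=> oU sf j; apply: smooth_on_eq (smooth_on_derive v (sf j)) => //.
by move=> x Ux; rewrite derive_rowE//; exact: vsmooth_differentiable Ux.
Qed.

(** By the chain rule a derivative of the composite is a finite sum of a component of ['D_v g] times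
    a partial derivative of [f] composed with [g]; the induction is over all [f], so it covers the
    second factor. *)
Lemma smooth_on_comp U (V : set 'rV[R]_n) (f : 'rV[R]_n -> R) g :
  open U -> (forall x, U x -> V (g x)) -> vsmooth_on U g -> smooth_on V f ->
  smooth_on U (fun x => f (g x)).
Proof.
move=> oU gV sg /smooth_onP sf; apply/smooth_onP => k; move: (sf k).
elim: k f {sf} => [|k IH] f sf; have [df Df] := sf; split=> //;
  try by move=> u Uu;
    apply: differentiable_comp (vsmooth_differentiable sg Uu) (df _ (gV _ Uu)).
move=> v.
apply: (@diff_order_eq _ _ k U
  (fun x => \sum_a (('D_v g x) 0 a * 'D_(basisv a) f (g x))) _ oU).
  move=> x Ux; rewrite -[LHS]derive_basis; last exact: df (gV _ Ux).
  by rewrite -derive_comp//; [exact: vsmooth_differentiable Ux|exact: df (gV _ Ux)].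
have smsum (I : Type) (r : seq I) (F : I -> 'rV[R]_m -> R) :
  (forall i, diff_order k U (F i)) -> diff_order k U (fun x => \sum_(i <- r) F i x).
  move=> sF; elim: r => [|i r IHr].
    by apply: (@diff_order_eq _ _ _ _ (cst 0) _ oU) => [x _|]; rewrite ?big_nil//;
      exact: diff_order_cst.
  apply: (@diff_order_eq _ _ _ _ (fun x => F i x + \sum_(i <- r) F i x) _ oU) => [x _|].
    by rewrite big_cons.
  by apply: diff_orderD.
apply: smsum => a; apply: diff_orderM => //; last exact: (IH _ (Df (basisv a))).
by have /smooth_onP := @vsmooth_derive U g v oU sg a.
Qed.

Lemma vsmoothD U f g : open U -> vsmooth_on U f -> vsmooth_on U g ->
  vsmooth_on U (fun x => f x + g x).
Proof.
move=> oU sf sg j; apply: smooth_on_eq (smooth_onD oU (sf j) (sg j)) => // x _.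
by rewrite mxE.
Qed.

Lemma vsmoothZ U (a : 'rV[R]_m -> R) g : open U -> smooth_on U a -> vsmooth_on U g ->
  vsmooth_on U (fun x => a x *: g x).
Proof.
move=> oU sf sg j; apply: smooth_on_eq (smooth_onM oU sf (sg j)) => // x _.
by rewrite mxE.
Qed.

Lemma vsmooth_sum U (I : Type) (r : seq I) (F : I -> 'rV[R]_m -> 'rV[R]_n) :
  open U -> (forall i, vsmooth_on U (F i)) ->
  vsmooth_on U (fun x => \sum_(i <- r) F i x).
Proof.
move=> oU sF j; apply: (@smooth_on_eq _ _ _ _ (fun x => \sum_(i <- r) F i x 0 j)) => //.
  by move=> x _; rewrite summxE.
by apply: smooth_on_sum => // i; exact: sF.
Qed.

End SmoothMaps.

(** * Symmetry of second derivatives *)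

Section Schwarz.
Context {R : realType} {n : nat}.
Implicit Types (U : set 'rV[R]_n) (f : 'rV[R]_n -> R) (p u v w : 'rV[R]_n).

Lemma is_derive_line f p v (s : R) : differentiable f (p + s *: v) ->
  is_derive s 1 (fun t : R => f (p + t *: v)) ('D_v f (p + s *: v)).
Proof.
move=> df.
have dl : differentiable (fun t : R => p + t *: v) s.
  by apply: differentiableD => //; exact: differentiableZl.
have Dl : 'D_1 (fun t : R => p + t *: v) s = v.
  rewrite deriveD//; last exact: (diff_derivable (differentiableZl _ _)).
  by rewrite derive_cst add0r deriveE ?diffZl//= ?diff_val ?scale1r.
have dc := differentiable_comp dl df.
apply: DeriveDef; first exact: diff_derivable dc.
by rewrite [LHS](derive_comp _ dl df) Dl.
Qed.

Lemma MVT_line f p v (d : R) : 0 < d ->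
  (forall s, 0 <= s <= d -> differentiable f (p + s *: v)) ->
  exists2 s, 0 < s < d & f (p + d *: v) - f p = d * 'D_v f (p + s *: v).
Proof.
move=> d0 df.
have H : forall s, s \in `]0, d[%R ->
    is_derive s 1 (fun t : R => f (p + t *: v)) ('D_v f (p + s *: v)).
  move=> s /[!in_itv]/= /andP[s0 sd]; apply: is_derive_line; apply: df.
  by rewrite !ltW.
have [|s] := MVT d0 H.
  apply: derivable_within_continuous => s /[!in_itv]/= sd.
  exact: (@ex_derive _ _ _ _ _ _ _ (is_derive_line (df s sd))).
rewrite in_itv/= => sd; rewrite scale0r addr0 subr0 mulrC => E.
by exists s.
Qed.

(** The mean value theorem is applied twice: along [v] to the increment of [f] in direction [w],
    then along [w] to ['D_v f]. The left-hand side is symmetric in [v] and [w], which is what makes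
    mixed derivatives comparable. *)
Lemma second_difference U f u v w (d : R) : open U -> smooth_on U f -> 0 < d ->
  (forall s t, 0 <= s <= d -> 0 <= t <= d -> U (u + s *: v + t *: w)) ->
  exists st : R * R, [/\ 0 < st.1 < d, 0 < st.2 < d &
    f (u + d *: v + d *: w) - f (u + d *: v) - f (u + d *: w) + f u =
    d * (d * 'D_w ('D_v f) (u + st.1 *: v + st.2 *: w))].
Proof.
move=> oU sf d0 UU.
have dd : 0 <= d <= d by rewrite lexx ltW.
have d00 : 0 <= (0 : R) <= d by rewrite lexx ltW.
pose g := fun x => f (x + d *: w) - f x.
have shE x : shift (d *: w) x = x + d *: w by [].
have dfs x : U (x + d *: w) -> differentiable (f \o shift (d *: w)) x.
  move=> Ux; apply: differentiable_comp; last exact: smooth_on_differentiable Ux.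
  exact: differentiableD.
have dg s : 0 <= s <= d -> differentiable g (u + s *: v).
  move=> sd; apply: differentiableB; first exact: dfs (UU _ _ sd dd).
  by apply: (smooth_on_differentiable sf); rewrite -[_ + _]addr0 -(scale0r w); exact: UU.
have [s sd] := MVT_line d0 dg; have sd' : 0 <= s <= d by case/andP: sd => ? ?; rewrite !ltW.
have -> : 'D_v g (u + s *: v) = 'D_v f (u + s *: v + d *: w) - 'D_v f (u + s *: v).
  rewrite /g deriveB; last 2 first.
  - by apply: diff_derivable; exact: dfs (UU _ _ sd' dd).
  - apply/diff_derivable/(smooth_on_differentiable sf).
    by rewrite -[_ + _]addr0 -(scale0r w); exact: UU.
  congr (_ - _); rewrite (@derive_comp _ _ _ _ f (shift (d *: w))).
  - by rewrite deriveD// derive_id derive_cst addr0.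
  - exact: differentiableD.
  - by apply: (smooth_on_differentiable sf); exact: UU.
have [t|t td ->] := @MVT_line ('D_v f) (u + s *: v) w d d0.
  move=> td; apply: (smooth_on_differentiable (smooth_on_derive v sf)); exact: UU.
move=> E; exists (s, t); split=> //=; rewrite -E /g; ring.
Qed.

Lemma nearby_parallelogram u v w (P : set 'rV[R]_n) : (\forall x \near u, P x) ->
  exists2 d : R, 0 < d &
    forall s t, 0 <= s <= d -> 0 <= t <= d -> P (u + s *: v + t *: w).
Proof.
move=> /nbhs_ballP[r /= r0 rP].
(* The summand 1 keeps the denominator positive when both directions vanish and makes the final
   estimate strict. *)
have q0 : 0 < `|v| + `|w| + 1 by rewrite ltr_wpDl// addr_ge0.
exists (r / (`|v| + `|w| + 1)); first exact: divr_gt0.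
move=> s t /andP[s0 sd] /andP[t0 td]; apply: rP.
rewrite -ball_normE /= -addrA opprD addrA subrr add0r normrN.
apply: le_lt_trans (ler_normD _ _) _; rewrite !normrZ !ger0_norm//.
have := ler_wpM2r (normr_ge0 v) sd; have := ler_wpM2r (normr_ge0 w) td => h1 h2.
apply: le_lt_trans (lerD h2 h1) _.
by rewrite -mulrDr -mulrA -[ltRHS]mulr1 ltr_pM2l// mulrC ltr_pdivrMr// mul1r ltrDl.
Qed.

Lemma near_dist_le f u (e : R) : 0 < e -> differentiable f u ->
  \forall x \near u, `|f u - f x| <= e.
Proof.
by move=> e0 df; move/cvgrPdist_le : (differentiable_continuous df); exact.
Qed.

Lemma ler_dist_half (a b x e : R) :
  `|a - x| <= e / 2 -> `|b - x| <= e / 2 -> `|b - a| <= e.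
Proof.
move=> ha hb; rewrite (splitr e) -(subrKA x); apply: le_trans (ler_normD _ _) _.
by apply: lerD => //; rewrite distrC.
Qed.

(** Computing one second difference in both orders shows that the two mixed derivatives agree at two
    points as close to [u] as desired; continuity of each at [u] closes the gap. *)
Lemma deriveC U f u v w : open U -> smooth_on U f -> U u ->
  'D_v ('D_w f) u = 'D_w ('D_v f) u.
Proof.
move=> oU sf Uu.
apply/eqP; rewrite -subr_eq0 -normr_le0; apply/ler_addgt0Pl => e e0; rewrite addr0.
have e20 : 0 < e / 2 by rewrite divr_gt0.
have nP : \forall x \near u, [/\ U x,
    `|'D_w ('D_v f) u - 'D_w ('D_v f) x| <= e / 2 &
    `|'D_v ('D_w f) u - 'D_v ('D_w f) x| <= e / 2].
  have near_D2 x y : \forall z \near u, `|'D_x ('D_y f) u - 'D_x ('D_y f) z| <= e / 2.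
    apply: near_dist_le e20 _; apply: (smooth_on_differentiable _ Uu).
    by do 2!apply: smooth_on_derive.
  by apply: filterS3 (near_open oU Uu) (near_D2 w v) (near_D2 v w) => x.
have [d d0 dP] := nearby_parallelogram v w nP.
have [|[s t] /= [sd td E1]] := @second_difference U f u v w d oU sf d0.
  by move=> s t sd td; have [] := dP s t sd td.
have [|[t' s'] /= [td' sd' E2]] := @second_difference U f u w v d oU sf d0.
  by move=> s' t' sd' td'; rewrite addrAC; have [] := dP t' s' td' sd'.
have W x : 0 < x < d -> 0 <= x <= d by case/andP => ? ?; rewrite !ltW.
have [_ B1 _] := dP s t (W _ sd) (W _ td).
have [_ _ B2] := dP s' t' (W _ sd') (W _ td').
have E : 'D_w ('D_v f) (u + s *: v + t *: w) = 'D_v ('D_w f) (u + s' *: v + t' *: w).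
  have dn := lt0r_neq0 d0; rewrite [u + s' *: v + _]addrAC.
  have : d * (d * 'D_w ('D_v f) (u + s *: v + t *: w)) =
         d * (d * 'D_v ('D_w f) (u + t' *: w + s' *: v)).
    have E3 : u + d *: w + d *: v = u + d *: v + d *: w by rewrite addrAC.
    move: E1 E2; rewrite E3.
    move: ('D_w _ _) ('D_v _ _) (f _) (f _) (f _) (f _) => X Y a1 a2 a3 a4 E1 E2.
    by rewrite -E1 -E2; ring.
  by move=> /(mulfI dn) /(mulfI dn).
rewrite -E in B2; move: B1 B2.
exact: ler_dist_half.
Qed.

End Schwarz.

(** * Partial derivatives and their rules on an open set *)

Fact pd_key : unit. Proof. exact: tt. Qed.

Section PartialDerivatives.
Context {R : realType} {n : nat}.

(* Locked: otherwise a failing comparison of two derivatives during rewriting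
   unfolds both down to limits of filters and does not terminate in practice. *)
Definition pd : 'I_n -> ('rV[R]_n -> R) -> 'rV[R]_n -> R :=
  locked_with pd_key (fun i f u => 'D_(basisv i) f u).

Lemma pdE i f u : pd i f u = 'D_(basisv i) f u.
Proof. by rewrite /pd unlock. Qed.

(** Taken componentwise so that vector rules reduce to those of [pd]; it agrees with the derivative
    of the map where the map is smooth ([vpdE]). *)
Definition vpd p (i : 'I_n) (f : 'rV[R]_n -> 'rV[R]_p) (u : 'rV[R]_n) : 'rV[R]_p :=
  \row_j pd i (fun x => f x 0 j) u.

Variable U : set 'rV[R]_n.
Hypothesis oU : open U.
Implicit Types (f g : 'rV[R]_n -> R).

Lemma pd_eq i f g u : (forall x, U x -> f x = g x) -> U u -> pd i f u = pd i g u.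
Proof. by move=> fg Uu; rewrite !pdE; exact: derive_eq_on Uu. Qed.

Lemma pdD i f g u : smooth_on U f -> smooth_on U g -> U u ->
  pd i (fun x => f x + g x) u = pd i f u + pd i g u.
Proof.
move=> sf sg Uu; rewrite !pdE [LHS]deriveD//; apply: diff_derivable.
  exact: smooth_on_differentiable Uu.
exact: smooth_on_differentiable Uu.
Qed.

Lemma pdM i f g u : smooth_on U f -> smooth_on U g -> U u ->
  pd i (fun x => f x * g x) u = f u * pd i g u + g u * pd i f u.
Proof.
move=> sf sg Uu; rewrite !pdE [LHS]deriveM//; apply: diff_derivable.
  exact: smooth_on_differentiable Uu.
exact: smooth_on_differentiable Uu.
Qed.

Lemma pd_cst i (c : R) u : pd i (fun=> c) u = 0.
Proof. by rewrite pdE derive_cst. Qed.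

Lemma pdZ i (c : R) f u : smooth_on U f -> U u ->
  pd i (fun x => c * f x) u = c * pd i f u.
Proof.
move=> sf Uu; rewrite pdM ?pd_cst ?mulr0 ?addr0//; exact: smooth_on_cst.
Qed.

Lemma pdN i f u : smooth_on U f -> U u -> pd i (fun x => - f x) u = - pd i f u.
Proof.
move=> sf Uu; rewrite -[RHS]mulN1r -pdZ//; apply: pd_eq => // x _.
by rewrite mulN1r.
Qed.

Lemma pd_sum i (I : Type) (r : seq I) (F : I -> 'rV[R]_n -> R) u :
  (forall j, smooth_on U (F j)) -> U u ->
  pd i (fun x => \sum_(j <- r) F j x) u = \sum_(j <- r) pd i (F j) u.
Proof.
move=> sF Uu; elim: r => [|j r IH].
  rewrite big_nil (pd_eq i (g := fun=> 0)) ?pd_cst// => x _.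
  by rewrite big_nil.
rewrite big_cons -IH -pdD//; last exact: smooth_on_sum.
by apply: pd_eq => // x _; rewrite big_cons.
Qed.

Lemma smooth_pd i f : smooth_on U f -> smooth_on U (pd i f).
Proof.
move=> sf; apply: smooth_on_eq (smooth_on_derive (basisv i) sf) => // x _.
by rewrite pdE.
Qed.

Lemma pdC i j f u : smooth_on U f -> U u -> pd i (pd j f) u = pd j (pd i f) u.
Proof.
move=> sf Uu.
have H a b : pd a (pd b f) u = 'D_(basisv a) ('D_(basisv b) f) u.
  rewrite pdE; apply: (derive_eq_on _ oU) Uu => x _; exact: pdE.
by rewrite (H i j) (H j i); exact: deriveC Uu.
Qed.

Lemma vpd_eq p i (f g : 'rV[R]_n -> 'rV[R]_p) u :
  (forall x, U x -> f x = g x) -> U u -> vpd i f u = vpd i g u.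
Proof.
by move=> fg Uu; apply/rowP => j; rewrite !mxE; apply: pd_eq => // x Ux; rewrite fg.
Qed.

Lemma vpdE p i (f : 'rV[R]_n -> 'rV[R]_p) u :
  vsmooth_on U f -> U u -> 'D_(basisv i) f u = vpd i f u.
Proof.
move=> sf Uu; apply/rowP => j; rewrite mxE pdE derive_rowE//.
exact: vsmooth_differentiable Uu.
Qed.

Lemma vsmooth_vpd p i (f : 'rV[R]_n -> 'rV[R]_p) : vsmooth_on U f -> vsmooth_on U (vpd i f).
Proof.
move=> sf j; apply: smooth_on_eq (smooth_pd i (sf j)) => // x _.
by rewrite mxE.
Qed.

End PartialDerivatives.

(** * Metrics and curvature in coordinates *)

Section Bilin.
Context {R : realType} {n : nat}.
Implicit Types (G : 'M[R]_n) (v w : 'rV[R]_n).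

Lemma bilinE G v w : bilin G v w = \sum_a \sum_b v 0 a * G a b * w 0 b.
Proof.
rewrite /bilin mxE exchange_big; apply: eq_bigr => b _.
by rewrite !mxE mulr_suml; apply: eq_bigr => a _.
Qed.

Lemma bilinDl G v v' w : bilin G (v + v') w = bilin G v w + bilin G v' w.
Proof. by rewrite /bilin !mulmxDl mxE. Qed.

Lemma bilinDr G v w w' : bilin G v (w + w') = bilin G v w + bilin G v w'.
Proof. by rewrite /bilin linearD mulmxDr mxE. Qed.

Lemma bilinZl G a v w : bilin G (a *: v) w = a * bilin G v w.
Proof. by rewrite /bilin -!scalemxAl mxE. Qed.

Lemma bilinZr G a v w : bilin G v (a *: w) = a * bilin G v w.
Proof. by rewrite /bilin linearZ -scalemxAr mxE. Qed.

Lemma bilinNl G v w : bilin G (- v) w = - bilin G v w.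
Proof. by rewrite -scaleN1r bilinZl mulN1r. Qed.

Lemma bilinNr G v w : bilin G v (- w) = - bilin G v w.
Proof. by rewrite -scaleN1r bilinZr mulN1r. Qed.

Lemma bilin0l G w : bilin G 0 w = 0.
Proof. by rewrite -(scale0r 0) bilinZl mul0r. Qed.

Lemma bilin0r G v : bilin G v 0 = 0.
Proof. by rewrite -(scale0r 0) bilinZr mul0r. Qed.

Lemma bilin_suml G (I : Type) (r : seq I) (F : I -> 'rV[R]_n) w :
  bilin G (\sum_(i <- r) F i) w = \sum_(i <- r) bilin G (F i) w.
Proof.
by elim: r => [|i r IH]; rewrite ?big_nil ?bilin0l// !big_cons bilinDl IH.
Qed.

Lemma bilinC G v w : G^T = G -> bilin G v w = bilin G w v.
Proof.
by move=> sG; rewrite /bilin -[in LHS](trmxK (_ *m _)) mxE !trmx_mul trmxK sG mulmxA.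
Qed.

Lemma bilin_basis G i j : bilin G (basisv i) (basisv j) = G i j.
Proof. by rewrite /bilin /basisv trmx_delta -rowE -colE !mxE. Qed.

Lemma posdef_unitmx G : posdef G -> G \in unitmx.
Proof.
move=> pG; rewrite -row_free_unit -kermx_eq0; apply: contraT => /rowV0Pn[v /sub_kermxP vG v0].
by have := pG v v0; rewrite /bilin vG mul0mx mxE ltxx.
Qed.

End Bilin.

(** * Christoffel symbols and metric compatibility *)

Section Christoffel.
Context {R : realType} {n : nat}.

(** Locked for the same reason as [pd]. *)
Definition gam : ('rV[R]_n -> 'M[R]_n) -> 'I_n -> 'I_n -> 'I_n -> 'rV[R]_n -> R :=
  locked_with pd_key christoffel.

Variable G : 'rV[R]_n -> 'M[R]_n.

Lemma gamE k i j u : gam G k i j u = christoffel G k i j u.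
Proof. by rewrite /gam unlock. Qed.

Lemma gam_pd k i j u : gam G k i j u = 2^-1 * \sum_l invmx (G u) k l *
  (pd i (fun x => G x l j) u + pd j (fun x => G x l i) u - pd l (fun x => G x i j) u).
Proof.
rewrite gamE; congr (_ * _); apply: eq_bigr => l _.
by rewrite (pdE i) (pdE j) (pdE l).
Qed.

Variable U : set 'rV[R]_n.
Hypothesis oU : open U.
Hypothesis sG : forall u, U u -> (G u)^T = G u.
Hypothesis pG : forall u, U u -> posdef (G u).
Hypothesis smG : forall i j, smooth_on U (fun u => G u i j).

Lemma metric_coefC i j u : U u -> G u i j = G u j i.
Proof. by move=> Uu; rewrite -{1}sG// mxE. Qed.

Lemma gamC k i j u : U u -> gam G k i j u = gam G k j i u.
Proof.
move=> Uu; rewrite !gam_pd; congr (_ * _); apply: eq_bigr => l _; congr (_ * _).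
rewrite [X in X - _]addrC; congr (_ - _).
by apply: (pd_eq oU) Uu => x; exact: metric_coefC.
Qed.

Lemma smooth_gam k i j : smooth_on U (gam G k i j).
Proof.
apply: smooth_on_eq (fun u _ => esym (gam_pd k i j u)) _ => //.
apply: smooth_onM => //; first exact: smooth_on_cst.
apply: smooth_on_sum => // l; apply: smooth_onM => //.
  by apply: smooth_on_invmx => // u Uu; exact/posdef_unitmx/pG.
apply: smooth_onD => //; first by apply: smooth_onD => //; exact: smooth_pd.
by apply: smooth_onN => //; exact: smooth_pd.
Qed.

(** Lowering the upper index cancels the inverse metric and leaves the Christoffel symbols of the
    first kind. *)
Lemma gam_lower l i j u : U u -> \sum_k gam G k i j u * G u k l =
  2^-1 * (pd i (fun x => G x l j) u + pd j (fun x => G x l i) u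
          - pd l (fun x => G x i j) u).
Proof.
move=> Uu; pose w q := pd i (fun x => G x q j) u + pd j (fun x => G x q i) u
          - pd q (fun x => G x i j) u.
have -> : \sum_k gam G k i j u * G u k l =
    2^-1 * \sum_q \sum_k G u l k * invmx (G u) k q * w q.
  rewrite exchange_big mulr_sumr; apply: eq_bigr => k _.
  rewrite gam_pd mulrAC -mulrA; congr (_ * _).
  rewrite metric_coefC// mulr_sumr; apply: eq_bigr => q _.
  by rewrite mulrA.
rewrite -/(w l); congr (_ * _); move: w => w.
have E q : \sum_k G u l k * invmx (G u) k q * w q = (l == q)%:R * w q.
  have := mulmxV (posdef_unitmx (pG Uu)) => /matrixP/(_ l q).
  by rewrite !mxE -mulr_suml => ->.
rewrite (eq_bigr _ (fun q _ => E q)) (bigD1 l)//= eqxx mul1r big1 ?addr0// => q.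
by rewrite eq_sym => /negPf ->; rewrite mul0r.
Qed.

(** The Levi-Civita connection preserves the metric: in the sum of two first-kind symbols everything
    cancels except twice the derivative of [G] in direction [i]. *)
Lemma gam_compat i a b u : U u -> pd i (fun x => G x a b) u =
  \sum_k gam G k i a u * G u k b + \sum_k gam G k i b u * G u k a.
Proof.
move=> Uu; rewrite !gam_lower//.
(* The three rewrites give symmetric entries of [G] one common index order, so that [lra] sees equal
   atoms. *)
rewrite (pd_eq oU i (g := fun x => G x a b) _ Uu); last by move=> x; exact: metric_coefC.
rewrite (pd_eq oU a (g := fun x => G x b i) _ Uu); last by move=> x; exact: metric_coefC.
rewrite (pd_eq oU b (g := fun x => G x a i) _ Uu); last by move=> x; exact: metric_coefC.
lra.
Qed.

End Christoffel.

(** * Algebraic curvature tensors *)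

Section CurvatureLike.
Context {R : realType} {V : zmodType}.
Variable S : V -> V -> V -> V -> R.
Hypothesis S_add2 : forall X Y Y' Z W, S X (Y + Y') Z W = S X Y Z W + S X Y' Z W.
Hypothesis S_add3 : forall X Y Z Z' W, S X Y (Z + Z') W = S X Y Z W + S X Y Z' W.
Hypothesis S_anti12 : forall X Y Z W, S X Y Z W = - S Y X Z W.
Hypothesis S_anti34 : forall X Y Z W, S X Y Z W = - S X Y W Z.
Hypothesis S_bianchi : forall X Y Z W, S X Y Z W + S Y Z X W + S Z X Y W = 0.

(** Octahedron argument: combine the four Bianchi identities in which each argument in turn occupies
    the last slot. *)
Lemma curvature_like_pairC X Y Z W : S X Y Z W = S Z W X Y.
Proof.
have := S_bianchi X Y Z W; have := S_bianchi Y Z W X.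
have := S_bianchi Z W X Y; have := S_bianchi W X Y Z.
rewrite (S_anti34 Y Z W) (S_anti34 Z W Y) (S_anti34 W Y Z) (S_anti12 W Y).
rewrite (S_anti34 Z W X) (S_anti34 W X Z) (S_anti34 X Z W) (S_anti12 X Z).
rewrite (S_anti34 W X Y) (S_anti34 X Y W) (S_anti12 Y W).
rewrite (S_anti12 W X Z).
lra.
Qed.

(** Polarizing the outer argument gives [T], polarizing the repeated middle one gives antisymmetry
    in the middle pair, [A]. The three Bianchi terms are then equal, so three times [S] vanishes. *)
Lemma curvature_like_eq0 :
  (forall X Y, S X Y Y X = 0) -> forall X Y Z W, S X Y Z W = 0.
Proof.
move=> S0.
have S_add1 X X' Y Z W : S (X + X') Y Z W = S X Y Z W + S X' Y Z W.
  by rewrite S_anti12 S_add2 opprD -!S_anti12.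
have S_add4 X Y Z W W' : S X Y Z (W + W') = S X Y Z W + S X Y Z W'.
  by rewrite S_anti34 S_add3 opprD -!S_anti34.
have T X Y Z : S X Y Y Z = 0.
  have := S0 (X + Z) Y; rewrite S_add1 !S_add4 !S0 add0r addr0.
  rewrite (curvature_like_pairC Z) (S_anti12 Y) (S_anti34 X Y Z); lra.
have A X Y Z W : S X Y Z W = - S X Z Y W.
  by have := T X (Y + Z) W; rewrite S_add2 !S_add3 !T; lra.
move=> X Y Z W; have := S_bianchi X Y Z W.
rewrite (S_anti12 Z) (A X Z) (S_anti12 Y Z) (A Z Y) (S_anti12 Z X) (A X Z); lra.
Qed.

End CurvatureLike.

(** * Symmetries of the Riemann tensor and constant curvature *)

Section Riemann.
Context {R : realType} {n : nat}.
Variable G : 'rV[R]_n -> 'M[R]_n.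
Variable U : set 'rV[R]_n.
Hypothesis oU : open U.
Hypothesis sG : forall u, U u -> (G u)^T = G u.
Hypothesis pG : forall u, U u -> posdef (G u).
Hypothesis smG : forall i j, smooth_on U (fun u => G u i j).
Implicit Types (X Y Z W : 'rV[R]_n).

Lemma curvature_coefE l i j k u : curvature_coef G l i j k u =
  pd i (gam G l j k) u - pd j (gam G l i k) u
  + \sum_p (gam G l i p u * gam G p j k u - gam G l j p u * gam G p i k u).
Proof.
have E l' i' j' : christoffel G l' i' j' = gam G l' i' j'.
  by apply/funext => x; rewrite gamE.
rewrite /curvature_coef !E !pdE; congr (_ + _).
by apply: eq_bigr => p _; rewrite !gamE.
Qed.

(* [conn i] and [riem i j] send the components of Z to those of nabla_i Z
   (minus the plain derivative) and of R(e_i, e_j) Z; they act on the right of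
   row vectors. *)
Let conn u i : 'M[R]_n := \matrix_(k, p) gam G p i k u.
Let dconn u i j : 'M[R]_n := \matrix_(k, p) pd i (gam G p j k) u.
Let riem u i j : 'M[R]_n := \matrix_(k, l) curvature_coef G l i j k u.

(** The commutator has its factors in reverse order because the matrices act on the right: nabla_i
    nabla_j contributes [conn u j *m conn u i]. *)
Let riemE u i j : riem u i j = dconn u i j - dconn u j i
  + (conn u j *m conn u i - conn u i *m conn u j).
Proof.
apply/matrixP => k l; rewrite !mxE curvature_coefE -sumrB; congr (_ + _).
by apply: eq_bigr => p _; rewrite !mxE mulrC [X in _ - X]mulrC.
Qed.

Let riem_anti u i j : riem u i j = - riem u j i.
Proof. by rewrite !riemE opprD !opprB. Qed.

Let compat u i a b : U u ->
  pd i (fun x => G x a b) u = (conn u i *m G u + G u *m (conn u i)^T) a b.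
Proof.
move=> Uu; rewrite (gam_compat oU sG pG)// !mxE; congr (_ + _).
  by apply: eq_bigr => k _; rewrite !mxE.
by apply: eq_bigr => k _; rewrite !mxE (metric_coefC sG k) // mulrC.
Qed.

(** [compat] is differentiated once more, and the first derivatives of the metric that appear are
    again eliminated by [compat]. *)
Let compat2 u i j a b : U u -> pd i (pd j (fun x => G x a b)) u =
  (dconn u i j *m G u + conn u j *m (conn u i *m G u + G u *m (conn u i)^T)
   + (conn u i *m G u + G u *m (conn u i)^T) *m (conn u j)^T
   + G u *m (dconn u i j)^T) a b.
Proof.
move=> Uu.
have smg := smooth_gam oU pG smG.
pose h (x : 'rV[R]_n) := \sum_k gam G k j a x * G x k b
   + \sum_k gam G k j b x * G x k a.
have E x : U x -> pd j (fun x => G x a b) x = h x by move=> Ux; rewrite (gam_compat oU sG pG).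
rewrite (pd_eq oU i E Uu) /h.
have sm c d : smooth_on U (fun x => \sum_k gam G k j c x * G x k d).
  by apply: smooth_on_sum => // k; exact: smooth_onM.
have D c d : pd i (fun x => \sum_k gam G k j c x * G x k d) u =
    (dconn u i j *m G u + conn u j *m (conn u i *m G u + G u *m (conn u i)^T)) c d.
  rewrite (pd_sum oU) //; last by move=> k; exact: smooth_onM.
  rewrite mxE [X in _ = X + _]mxE [X in _ = _ + X]mxE -big_split /=; apply: eq_bigr => k _.
  rewrite (pdM i (smg k j c) (smG k d) Uu) (compat i k d Uu) addrC [X in X + _]mulrC.
  by rewrite [dconn u i j c k]mxE [conn u j c k]mxE; congr (_ + _); rewrite mulrC.
rewrite (pdD i (sm a b) (sm b a) Uu) !D [RHS]mxE [X in _ = X + _]mxE.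
rewrite -addrA; congr (_ + _).
have -> : (dconn u i j *m G u + conn u j *m (conn u i *m G u + G u *m (conn u i)^T)) b a =
   ((dconn u i j *m G u + conn u j *m (conn u i *m G u + G u *m (conn u i)^T))^T) a b.
  by rewrite [RHS]mxE.
rewrite linearD /= !trmx_mul linearD /= !trmx_mul trmxK sG// [LHS]mxE addrC.
by congr (fun_of_matrix (_ *m _) _ _ + _); rewrite addrC.
Qed.

(** [A] stands for the metric, [B] and [C] for the connection matrices in directions i and j, [D]
    for the i-derivative of [C] and [E] for the j-derivative of [B]. The mixed terms [C *m A *m B^T]
    and [B *m A *m C^T] occur on both sides and drop out; the rest is skewness of the lowered
    curvature. *)
Let commutator_anti (A B C D E : 'M[R]_n) a b : A^T = A ->
  (D *m A + C *m (B *m A + A *m B^T) + (B *m A + A *m B^T) *m C^T + A *m D^T) a b =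
  (E *m A + B *m (C *m A + A *m C^T) + (C *m A + A *m C^T) *m B^T + A *m E^T) a b ->
  ((D - E + (C *m B - B *m C)) *m A) a b =
  - ((D - E + (C *m B - B *m C)) *m A) b a.
Proof.
move=> sA.
have -> : ((D - E + (C *m B - B *m C)) *m A) b a =
          (A *m (D - E + (C *m B - B *m C))^T) a b.
  by rewrite -[A in RHS]sA -trmx_mul [RHS]mxE.
have -> : (D - E + (C *m B - B *m C))^T = D^T - E^T + (B^T *m C^T - C^T *m B^T).
  by rewrite -!trmx_mul; apply/matrixP => k l; rewrite !mxE.
rewrite !(mulmxDl, mulmxDr, mulNmx, mulmxN) !mulmxA.
move: (D *m A) (E *m A) (C *m B *m A) (B *m C *m A) (C *m A *m B^T) (B *m A *m C^T)
  (A *m D^T) (A *m E^T) (A *m C^T *m B^T) (A *m B^T *m C^T).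
by move=> ? ? ? ? ? ? ? ? ? ?; rewrite !mxE; lra.
Qed.

(** This is the equality of the mixed second derivatives of the metric, rewritten through
    [compat2]. *)
Let riem_lower_anti u i j : U u ->
  riem u i j *m G u = - (riem u i j *m G u)^T.
Proof.
move=> Uu; apply/matrixP => a b.
have := pdC oU i j (smG a b) Uu.
rewrite (compat2 i j a b Uu) (compat2 j i a b Uu) => H.
rewrite riemE; apply: (etrans (commutator_anti (sG Uu) H)).
by rewrite [RHS]mxE; congr (- _); rewrite [RHS]mxE.
Qed.

Definition riem_op u X Y : 'M[R]_n := \sum_i \sum_j (X 0 i * Y 0 j) *: riem u i j.

Lemma curvatureE u X Y Z : curvature G u X Y Z = Z *m riem_op u X Y.
Proof.
apply/rowP => l; rewrite /riem_op !mxE.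
transitivity (\sum_k \sum_i \sum_j curvature_coef G l i j k u * X 0 i * Y 0 j * Z 0 k).
  rewrite [RHS]exchange_big; apply: eq_bigr => i _.
  by rewrite [RHS]exchange_big.
apply: eq_bigr => k _; rewrite summxE mulr_sumr; apply: eq_bigr => i _.
rewrite summxE mulr_sumr; apply: eq_bigr => j _.
by rewrite !mxE; ring.
Qed.

Lemma curvature_anti12 u X Y Z : curvature G u X Y Z = - curvature G u Y X Z.
Proof.
rewrite !curvatureE -mulmxN; congr (_ *m _).
rewrite /riem_op exchange_big -sumrN; apply: eq_bigr => j _.
rewrite -sumrN; apply: eq_bigr => i _.
by rewrite riem_anti scalerN mulrC.
Qed.

Lemma curvature_anti34 u X Y Z W : U u ->
  bilin (G u) (curvature G u X Y Z) W = - bilin (G u) (curvature G u X Y W) Z.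
Proof.
move=> Uu; rewrite !curvatureE /bilin.
have -> : (Z *m riem_op u X Y *m G u *m W^T) 0 0 =
   (W *m (riem_op u X Y *m G u)^T *m Z^T) 0 0.
  have tr1 (A : 'M[R]_1) : A 0 0 = A^T 0 0 by rewrite mxE.
  by rewrite [LHS]tr1 !trmx_mul trmxK !mulmxA.
have -> : (riem_op u X Y *m G u)^T = - (riem_op u X Y *m G u).
  rewrite /riem_op mulmx_suml linear_sum -sumrN; apply: eq_bigr => i _.
  rewrite /= mulmx_suml linear_sum -sumrN; apply: eq_bigr => j _.
  rewrite -scalemxAl linearZ /= -scalerN; congr (_ *: _).
  by rewrite [in RHS](riem_lower_anti i j Uu) opprK.
by rewrite mulmxN mulNmx [LHS]mxE !mulmxA.
Qed.

(** Once [gamC] has made the lower indices symmetric, derivative terms and quadratic terms cancel in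
    pairs around the cycle. *)
Lemma curvature_coef_bianchi l i j k u : U u ->
  curvature_coef G l i j k u + curvature_coef G l j k i u
  + curvature_coef G l k i j u = 0.
Proof.
move=> Uu; rewrite !curvature_coefE.
have D a b c : pd a (gam G l b c) u = pd a (gam G l c b) u.
  by apply: (pd_eq oU) Uu => x Ux; exact: gamC oU sG _ _ _ _ Ux.
rewrite (D i k j) (D j k i) (D k j i).
rewrite [X in _ + X + _](_ : _ = pd j (gam G l i k) u - pd k (gam G l i j) u +
   \sum_p (gam G l j p u * gam G p i k u - gam G l k p u * gam G p i j u)); last first.
  congr (_ + _); apply: eq_bigr => p _.
  by rewrite (gamC oU sG p k i Uu) (gamC oU sG p j i Uu).
rewrite [X in _ + _ + X](_ : _ = pd k (gam G l i j) u - pd i (gam G l j k) u +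
   \sum_p (gam G l k p u * gam G p i j u - gam G l i p u * gam G p j k u)); last first.
  congr (_ + _); apply: eq_bigr => p _.
  by rewrite (gamC oU sG p k j Uu).
rewrite !sumrB; generalize (\sum_p gam G l i p u * gam G p j k u),
  (\sum_p gam G l j p u * gam G p i k u), (\sum_p gam G l k p u * gam G p i j u),
  (pd i (gam G l j k) u), (pd j (gam G l i k) u), (pd k (gam G l i j) u) => *.
ring.
Qed.

Lemma curvature_bianchi u X Y Z : U u ->
  curvature G u X Y Z + curvature G u Y Z X + curvature G u Z X Y = 0.
Proof.
move=> Uu; apply/rowP => l; rewrite !mxE.
have -> : \sum_i \sum_j \sum_k curvature_coef G l i j k u * Y 0 i * Z 0 j * X 0 k =
  \sum_i \sum_j \sum_k curvature_coef G l j k i u * X 0 i * Y 0 j * Z 0 k.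
  rewrite [RHS]exchange_big; apply: eq_bigr => i _.
  rewrite [RHS]exchange_big; apply: eq_bigr => j _.
  by apply: eq_bigr => k _; rewrite mulrAC -!mulrA; congr (_ * _); ring.
have -> : \sum_i \sum_j \sum_k curvature_coef G l i j k u * Z 0 i * X 0 j * Y 0 k =
  \sum_i \sum_j \sum_k curvature_coef G l k i j u * X 0 i * Y 0 j * Z 0 k.
  rewrite exchange_big; apply: eq_bigr => i _.
  rewrite exchange_big; apply: eq_bigr => j _.
  by apply: eq_bigr => k _; rewrite -!mulrA; congr (_ * _); ring.
rewrite -!big_split /= big1 // => i _; rewrite -!big_split /= big1 // => j _.
rewrite -!big_split /= big1 // => k _.
by rewrite -!mulrDl curvature_coef_bianchi // !mul0r.
Qed.

Lemma curvatureDr u X Y Z Z' :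
  curvature G u X Y (Z + Z') = curvature G u X Y Z + curvature G u X Y Z'.
Proof. by rewrite !curvatureE mulmxDl. Qed.

Lemma curvatureDm u X Y Y' Z :
  curvature G u X (Y + Y') Z = curvature G u X Y Z + curvature G u X Y' Z.
Proof.
rewrite !curvatureE -mulmxDr; congr (_ *m _).
rewrite /riem_op -big_split; apply: eq_bigr => i _.
rewrite -big_split; apply: eq_bigr => j _.
by rewrite mxE mulrDr scalerDl.
Qed.

(** The vector [w] is |Y|^2 times the part of [X] orthogonal to [Y], and its squared length is |Y|^2
    times the Gram determinant. *)
Lemma free2_gram_neq0 (A : 'M[R]_n) X Y : A^T = A -> posdef A -> free [:: X; Y] ->
  bilin A X X * bilin A Y Y - bilin A X Y ^+ 2 != 0.
Proof.
move=> sA pA; rewrite free_cons span_seq1 => /andP[XY fY].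
have Y0 : Y != 0 by apply: contraNneq XY => Y0; move: fY; rewrite Y0 seq1_free eqxx.
have bY := pA Y Y0; pose w := bilin A Y Y *: X - bilin A X Y *: Y.
have w0 : w != 0.
  apply: contraNneq XY => /eqP; rewrite subr_eq0 => /eqP E.
  apply/vlineP; exists ((bilin A Y Y)^-1 * bilin A X Y).
  by rewrite -scalerA -E scalerA mulVf ?scale1r// gt_eqF.
have : bilin A w w = bilin A Y Y * (bilin A X X * bilin A Y Y - bilin A X Y ^+ 2).
  rewrite /w !(bilinDl, bilinDr, bilinZl, bilinZr, bilinNl, bilinNr) (bilinC Y X sA).
  ring.
move=> E; apply: contraTneq (pA w w0) => D0.
by rewrite E D0 mulr0 ltxx.
Qed.

(** The difference [S] between the curvature and the constant-curvature model has all curvature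
    symmetries, so it suffices that it vanishes on X, Y, Y, X. *)
Lemma constant_curvature_tensor (c : R) u : U u ->
  (forall X Y, free [:: X; Y] -> sectional_curvature G u X Y = c) ->
  forall X Y Z W, bilin (G u) (curvature G u X Y Z) W =
    c * (bilin (G u) Y Z * bilin (G u) X W - bilin (G u) X Z * bilin (G u) Y W).
Proof.
move=> Uu sc X Y Z W; apply/eqP; rewrite -subr_eq0; apply/eqP.
pose S X Y Z W := bilin (G u) (curvature G u X Y Z) W -
  c * (bilin (G u) Y Z * bilin (G u) X W - bilin (G u) X Z * bilin (G u) Y W).
have bC := bilinC _ _ (sG Uu).
rewrite -/(S X Y Z W); move: X Y Z W; apply: curvature_like_eq0; rewrite /S.
- by move=> X Y Y' Z W; rewrite curvatureDm !bilinDl; ring.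
- by move=> X Y Z Z' W; rewrite curvatureDr !bilinDl !bilinDr; ring.
- by move=> X Y Z W; rewrite curvature_anti12 bilinNl; ring.
- by move=> X Y Z W; rewrite curvature_anti34//; ring.
- move=> X Y Z W; have := congr1 (fun V => bilin (G u) V W) (curvature_bianchi X Y Z Uu).
  rewrite /= !bilinDl bilin0l => E.
  by rewrite -[RHS]E (bC Z X) (bC Z Y) (bC Y X); ring.
move=> {}X {}Y.
have [fXY|] := boolP (free [:: X; Y]).
  have D0 := free2_gram_neq0 (sG Uu) (pG Uu) fXY.
  have := sc _ _ fXY; rewrite /sectional_curvature => /(canRL (divfK D0)) ->.
  by rewrite (bC Y X); ring.
(* For dependent [X] and [Y] the curvature hypothesis is silent, but both terms of [S] vanish by
   antisymmetry. In dimension one this is the only case. *)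
rewrite free_cons span_seq1 seq1_free negb_and !negbK => /orP[/vlineP[k ->]|/eqP ->].
  have : bilin (G u) (curvature G u (k *: Y) Y Y) Y = 0.
    by have := curvature_anti34 (k *: Y) Y Y Y Uu; lra.
  by rewrite bilinZr => ->; rewrite !bilinZl !bilinZr; ring.
by rewrite curvature_anti34// !bilin0r bilin0l; ring.
Qed.

End Riemann.

Lemma curvature_coef_anti (R : realType) n (G : 'rV[R]_n -> 'M[R]_n) l i j k u :
  curvature_coef G l i j k u = - curvature_coef G l j i k u.
Proof. by rewrite !curvature_coefE !sumrB opprD !opprB. Qed.

(** * Connection and curvature of a product with the real line *)

Section ProductWithLine.
Context {R : realType} {m : nat}.
Variable G : 'rV[R]_m -> 'M[R]_m.
Variable V : set 'rV[R]_m.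
Hypothesis oV : open V.
Hypothesis sG : forall u, V u -> (G u)^T = G u.
Hypothesis pG : forall u, V u -> posdef (G u).
Hypothesis smG : forall i j, smooth_on V (fun u => G u i j).

Let K (y : 'rV[R]_(m + 1)) : 'M[R]_(m + 1) := block_mx (G (lsubmx y)) 0 0 1%:M.
Let W : set 'rV[R]_(m + 1) := lsubmx @^-1` V.

Let oW : open W.
Proof. by apply: open_comp => // ? _; exact: continuous_lsubmx. Qed.

Lemma pd_lsubmx_l i (f : 'rV[R]_m -> R) (y : 'rV[R]_(m + 1)) :
  pd (lshift 1 i) (fun x => f (lsubmx x)) y = pd i f (lsubmx y).
Proof.
rewrite !pdE [LHS](@derive_precomp R _ _ (@lsubmx R 1 m 1) _ f).
congr ('D_ _ _ _); apply/rowP => j.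
by rewrite !mxE eq_lshift.
Qed.

Lemma pd_lsubmx_r i (f : 'rV[R]_m -> R) (y : 'rV[R]_(m + 1)) :
  pd (rshift m i) (fun x => f (lsubmx x)) y = 0.
Proof.
rewrite pdE [LHS](@derive_precomp R _ _ (@lsubmx R 1 m 1) _ f).
rewrite -[RHS](derive0 f (lsubmx y)); congr ('D_ _ _ _); apply/rowP => j.
by rewrite !mxE eq_lrshift.
Qed.

Let K_l j k y : K y (lshift 1 j) (lshift 1 k) = G (lsubmx y) j k.
Proof. exact: block_mxEul. Qed.

Let pdK_l i j k y : pd (lshift 1 i) (fun x => K x (lshift 1 j) (lshift 1 k)) y =
  pd i (fun x => G x j k) (lsubmx y).
Proof.
by rewrite -pd_lsubmx_l; apply: (pd_eq openT) => // x _; exact: K_l.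
Qed.

Let pdK_r1 a b i y : pd (rshift m i) (fun x => K x a b) y = 0.
Proof.
case: (split_ordP a) => j ->; case: (split_ordP b) => k ->; last first.
- by rewrite (pd_eq openT _ (g := fun=> 1%:M j k)) ?pd_cst// => x _; rewrite /K block_mxEdr.
- by rewrite (pd_eq openT _ (g := fun=> 0)) ?pd_cst// => x _; rewrite /K block_mxEdl mxE.
- by rewrite (pd_eq openT _ (g := fun=> 0)) ?pd_cst// => x _; rewrite /K block_mxEur mxE.
rewrite -[RHS](pd_lsubmx_r i (fun x => G x j k) y).
by apply: (pd_eq openT) => // x _; exact: K_l.
Qed.

Let pdK_r2 a b i y : pd a (fun x => K x (rshift m i) b) y = 0.
Proof.
case: (split_ordP b) => k ->.
  by rewrite (pd_eq openT _ (g := fun=> 0)) ?pd_cst// => x _; rewrite /K block_mxEdl mxE.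
by rewrite (pd_eq openT _ (g := fun=> 1%:M i k)) ?pd_cst// => x _; rewrite /K block_mxEdr.
Qed.

Let pdK_r3 a b i y : pd a (fun x => K x b (rshift m i)) y = 0.
Proof.
case: (split_ordP b) => k ->.
  by rewrite (pd_eq openT _ (g := fun=> 0)) ?pd_cst// => x _; rewrite /K block_mxEur mxE.
by rewrite (pd_eq openT _ (g := fun=> 1%:M k i)) ?pd_cst// => x _; rewrite /K block_mxEdr.
Qed.

Let invK y : W y -> invmx (K y) = block_mx (invmx (G (lsubmx y))) 0 0 1%:M.
Proof.
move=> Wy; rewrite invmx_block_diag ?invmx1//.
by rewrite block_diag_mx_unit unitmx1 andbT; exact/posdef_unitmx/pG.
Qed.

(** [K] and its inverse are block diagonal, the line block is constant and nothing depends on the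
    line coordinate; hence only symbols with all three indices in the first factor survive. *)
Lemma gam_prod_l k i j y : W y ->
  gam K (lshift 1 k) (lshift 1 i) (lshift 1 j) y = gam G k i j (lsubmx y).
Proof.
move=> Wy; rewrite !gam_pd invK//; congr (_ * _); rewrite big_split_ord /=.
rewrite [X in _ + X]big1 ?addr0 => [|l _]; last by rewrite block_mxEur mxE mul0r.
by apply: eq_bigr => l _; rewrite block_mxEul !pdK_l.
Qed.

Lemma gam_prod_r1 k i j y : W y -> gam K (rshift m k) i j y = 0.
Proof.
move=> Wy; rewrite gam_pd invK// big_split_ord /=.
rewrite !big1 ?addr0 ?mulr0// => l _; last by rewrite block_mxEdl mxE mul0r.
by rewrite !pdK_r1 !pdK_r2 addr0 subr0 mulr0.
Qed.

Lemma gam_prod_r2 k i j y : W y -> gam K k (rshift m i) j y = 0.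
Proof.
move=> Wy; case: (split_ordP k) => k' ->; last exact: gam_prod_r1.
rewrite gam_pd invK// big_split_ord /=.
rewrite !big1 ?addr0 ?mulr0// => l _; first by rewrite block_mxEur mxE mul0r.
by rewrite !pdK_r1 !pdK_r2 !pdK_r3 addr0 subr0 mulr0.
Qed.

Lemma gam_prod_r3 k i j y : W y -> gam K k j (rshift m i) y = 0.
Proof.
move=> Wy; case: (split_ordP k) => k' ->; last exact: gam_prod_r1.
rewrite gam_pd invK// big_split_ord /=.
rewrite !big1 ?addr0 ?mulr0// => l _; first by rewrite block_mxEur mxE mul0r.
by rewrite !pdK_r1 !pdK_r3 addr0 subr0 mulr0.
Qed.

Let zero_on (f : 'rV[R]_(m + 1) -> R) i y : (forall x, W x -> f x = 0) -> W y -> pd i f y = 0.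
Proof. by move=> f0 Wy; rewrite (pd_eq oW i (g := fun=> 0))// pd_cst. Qed.

Lemma curvature_prod_coef_l l i j k y : W y ->
  curvature_coef K (lshift 1 l) (lshift 1 i) (lshift 1 j) (lshift 1 k) y =
  curvature_coef G l i j k (lsubmx y).
Proof.
move=> Wy; rewrite !curvature_coefE.
have D a b c : pd (lshift 1 a) (gam K (lshift 1 l) (lshift 1 b) (lshift 1 c)) y =
    pd a (gam G l b c) (lsubmx y).
  by rewrite -pd_lsubmx_l; apply: (pd_eq oW) => // x; exact: gam_prod_l.
rewrite !D big_split_ord /= [X in _ + (_ + X)]big1 => [|p _]; last first.
  by rewrite !gam_prod_r1// !mulr0 subr0.
by rewrite addr0; congr (_ + _); apply: eq_bigr => p _; rewrite !gam_prod_l.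
Qed.

Lemma curvature_prod_coef_r1 l i j k y : W y ->
  curvature_coef K (rshift m l) i j k y = 0.
Proof.
move=> Wy; rewrite curvature_coefE !zero_on//; try by move=> x; exact: gam_prod_r1.
by rewrite subr0 add0r big1// => p _; rewrite !gam_prod_r1// !mul0r subr0.
Qed.

(** The one term not killed by a vanishing symbol is the line derivative of a symbol of [G], which
    depends on the first factor only. *)
Lemma curvature_prod_coef_r2 l i j k y : W y ->
  curvature_coef K l (rshift m i) j k y = 0.
Proof.
move=> Wy; rewrite curvature_coefE [X in _ - X]zero_on//; last first.
  by move=> x; exact: gam_prod_r2.
rewrite subr0 big1 ?addr0 => [|p _]; last by rewrite !gam_prod_r2// mul0r mulr0 subr0.
case: (split_ordP l) => l' ->; last by apply: zero_on => // x; exact: gam_prod_r1.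
case: (split_ordP j) => j' ->; last by apply: zero_on => // x; exact: gam_prod_r2.
case: (split_ordP k) => k' ->; last by apply: zero_on => // x; exact: gam_prod_r3.
rewrite -[RHS](pd_lsubmx_r i (gam G l' j' k') y).
by apply: (pd_eq oW) => // x; exact: gam_prod_l.
Qed.

Lemma curvature_prod_coef_r3 l i j k y : W y ->
  curvature_coef K l j (rshift m i) k y = 0.
Proof.
by move=> Wy; rewrite curvature_coef_anti curvature_prod_coef_r2// oppr0.
Qed.

Lemma curvature_prod_coef_r4 l i j k y : W y ->
  curvature_coef K l i j (rshift m k) y = 0.
Proof.
move=> Wy; rewrite curvature_coefE !zero_on//; try by move=> x; exact: gam_prod_r3.
by rewrite subr0 add0r big1// => p _; rewrite !gam_prod_r3// !mulr0 subr0.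
Qed.

(** The curvature sees only the projections of its arguments to the first factor: the line direction
    is flat and parallel. *)
Lemma curvature_prod y X Y Z : W y ->
  curvature K y X Y Z =
  row_mx (curvature G (lsubmx y) (lsubmx X) (lsubmx Y) (lsubmx Z)) 0.
Proof.
move=> Wy; apply/rowP => l; rewrite [LHS]mxE.
case: (split_ordP l) => l' ->; rewrite ?row_mxEl ?row_mxEr [RHS]mxE; last first.
  do 3!(rewrite big1// => ? _).
  by rewrite curvature_prod_coef_r1// !mul0r.
rewrite big_split_ord /= [X in _ + X]big1 ?addr0 => [|i _]; last first.
  do 2!(rewrite big1// => ? _).
  by rewrite curvature_prod_coef_r2// !mul0r.
apply: eq_bigr => i _.
rewrite big_split_ord /= [X in _ + X]big1 ?addr0 => [|j _]; last first.
  rewrite big1// => ? _.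
  by rewrite curvature_prod_coef_r3// !mul0r.
apply: eq_bigr => j _.
rewrite big_split_ord /= [X in _ + X]big1 ?addr0 => [|k _]; last first.
  by rewrite curvature_prod_coef_r4// !mul0r.
by apply: eq_bigr => k _; rewrite curvature_prod_coef_l// !mxE.
Qed.

Lemma bilin_prod y X Y : bilin (K y) X Y =
  bilin (G (lsubmx y)) (lsubmx X) (lsubmx Y) + X 0 (rshift m 0) * Y 0 (rshift m 0).
Proof.
rewrite /K bilin_block; congr (_ + _).
by rewrite /bilin mulmx1 mxE big_ord1 !mxE.
Qed.

End ProductWithLine.

(** * Umbilical hypersurfaces *)

Section MetricTrace.
Context {R : realType} {m : nat}.
Variable g : 'M[R]_m.
Hypothesis sg : g^T = g.
Hypothesis ug : g \in unitmx.

(** Trace of a bilinear form with respect to [g], in components of a coordinate frame. *)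
Definition mtrace (f : 'I_m -> 'I_m -> R) : R := \sum_i \sum_j invmx g i j * f i j.

Lemma mtraceD f f' : mtrace (fun i j => f i j + f' i j) = mtrace f + mtrace f'.
Proof.
rewrite /mtrace -big_split; apply: eq_bigr => i _; rewrite -big_split.
by apply: eq_bigr => j _; rewrite mulrDr.
Qed.

Lemma mtraceZ a f : mtrace (fun i j => a * f i j) = a * mtrace f.
Proof.
rewrite /mtrace mulr_sumr; apply: eq_bigr => i _; rewrite mulr_sumr.
by apply: eq_bigr => j _; rewrite mulrCA.
Qed.

Lemma eq_mtrace f f' : (forall i j, f i j = f' i j) -> mtrace f = mtrace f'.
Proof. by move=> E; do 2!(apply: eq_bigr => ? _); rewrite E. Qed.

Let gC i j : g i j = g j i. Proof. by rewrite -{1}sg mxE. Qed.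

Let iC i j : invmx g i j = invmx g j i.
Proof. by rewrite -{1}sg -trmx_inv mxE. Qed.

Let invg j l : \sum_i invmx g j i * g i l = (j == l)%:R.
Proof. by have /matrixP/(_ j l) := mulVmx ug; rewrite !mxE. Qed.

Let invg' j l : \sum_i invmx g i j * g i l = (j == l)%:R.
Proof. by rewrite -invg; apply: eq_bigr => i _; rewrite iC. Qed.

Let sum_delta (a : 'I_m -> R) l : \sum_j (j == l)%:R * a j = a l.
Proof.
rewrite (bigD1 l)//= eqxx mul1r big1 ?addr0// => j /negPf ->.
by rewrite mul0r.
Qed.

Lemma mtrace_metric : mtrace g = m%:R.
Proof.
rewrite /mtrace (eq_bigr (fun=> 1)); first by rewrite sumr_const card_ord.
move=> i _; transitivity ((i == i)%:R : R); last by rewrite eqxx.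
rewrite -invg.
by apply: eq_bigr => j _; rewrite gC.
Qed.

(** Raising an index and lowering it again: the coordinate form of expanding a covector in an
    orthonormal frame. *)
Lemma mtrace_l (a : 'I_m -> R) l : mtrace (fun i j => a j * g i l) = a l.
Proof.
rewrite /mtrace exchange_big -[RHS]sum_delta; apply: eq_bigr => j _.
by rewrite -invg' mulr_suml; apply: eq_bigr => i _; ring.
Qed.

Lemma mtrace_r (a : 'I_m -> R) l : mtrace (fun i j => a i * g j l) = a l.
Proof.
rewrite /mtrace -[RHS]sum_delta; apply: eq_bigr => i _.
by rewrite -invg mulr_suml; apply: eq_bigr => j _; ring.
Qed.

End MetricTrace.

Lemma mul_bilin (R : realType) n p q (A : 'M[R]_(p, n)) (B : 'M[R]_(q, n)) (K : 'M[R]_n) i j :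
  (A *m K *m B^T) i j = bilin K (row i A) (row j B).
Proof.
by rewrite /bilin -row_mul !mxE; apply: eq_bigr => k _; rewrite !mxE.
Qed.

(** * The first-integral argument for a frame, a normal and a connection along an open set *)

Section UmbilicalHypersurface.
Context {R : realType} {m : nat}.
Variable U : set 'rV[R]_m.
Hypothesis oU : open U.
Variable g : 'rV[R]_m -> 'M[R]_m.
Hypothesis sg : forall u, U u -> (g u)^T = g u.
Hypothesis pg : forall u, U u -> posdef (g u).
Variable K : 'rV[R]_m -> 'M[R]_(m + 1).
Hypothesis sK : forall u, U u -> (K u)^T = K u.
Hypothesis uK : forall u, U u -> K u \in unitmx.
Variables (E : 'I_m -> 'rV[R]_m -> 'rV[R]_(m + 1)) (xi : 'rV[R]_m -> 'rV[R]_(m + 1)).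
Hypothesis smE : forall i, vsmooth_on U (E i).
Hypothesis smxi : vsmooth_on U xi.
(** Zeroth-order part of the induced connection, kept abstract: the computation sees it through
    linearity, absence of torsion, metric compatibility and the parallelism of d/dt. *)
Variable conn : 'rV[R]_m -> 'I_m -> 'rV[R]_(m + 1) -> 'rV[R]_(m + 1).
Hypothesis connD : forall u i (V W : 'rV[R]_(m + 1)), conn u i (V + W) = conn u i V + conn u i W.
Hypothesis connZ : forall u i a (V : 'rV[R]_(m + 1)), conn u i (a *: V) = a *: conn u i V.

Let nab i (V : 'rV[R]_m -> 'rV[R]_(m + 1)) u := vpd i V u + conn u i (V u).
Let nd i j u := nab i (E j) u - \sum_k gam g k i j u *: E k u.
Let ip u := bilin (K u).
Let t0 : 'I_(m + 1) := rshift m 0.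

Hypothesis nabC : forall i j u, U u -> nab i (E j) u = nab j (E i) u.
Hypothesis nab_metric : forall i V W u, vsmooth_on U V -> vsmooth_on U W -> U u ->
  pd i (fun x => ip x (V x) (W x)) u = ip u (nab i V u) (W u) + ip u (V u) (nab i W u).
(** With [ip_t] the last component of a vector is its product with d/dt; [conn_t] then says that
    d/dt is parallel, since differentiating that component commutes with [nab]. *)
Hypothesis ip_t : forall u V, U u -> ip u (basisv t0) V = V 0 t0.
Hypothesis conn_t : forall u i V, U u -> conn u i V 0 t0 = 0.
Hypothesis ipEE : forall u i j, U u -> ip u (E i u) (E j u) = g u i j.
Hypothesis ipExi : forall u i, U u -> ip u (E i u) (xi u) = 0.
Hypothesis ipxi : forall u, U u -> ip u (xi u) (xi u) = 1.
Variable H : 'rV[R]_m -> R.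
Hypothesis smH : smooth_on U H.
Hypothesis umbilic : forall i j u, U u -> ip u (nd i j u) (xi u) = H u * g u i j.

Let ipC u V W : U u -> ip u V W = ip u W V.
Proof. by move=> Uu; exact: bilinC (sK Uu). Qed.

Let ipDl u V W X : ip u (V + W) X = ip u V X + ip u W X. Proof. exact: bilinDl. Qed.
Let ipDr u V W X : ip u X (V + W) = ip u X V + ip u X W. Proof. exact: bilinDr. Qed.
Let ipZl u a V X : ip u (a *: V) X = a * ip u V X. Proof. exact: bilinZl. Qed.
Let ipZr u a V X : ip u X (a *: V) = a * ip u X V. Proof. exact: bilinZr. Qed.
Let ipNl u V X : ip u (- V) X = - ip u V X. Proof. exact: bilinNl. Qed.

Let ip_suml u (F : 'I_m -> 'rV[R]_(m + 1)) W :
  ip u (\sum_k F k) W = \sum_k ip u (F k) W.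
Proof. exact: bilin_suml. Qed.

Let sum_ipE (a : 'I_m -> R) V u :
  ip u (\sum_k a k *: E k u) V = \sum_k a k * ip u (E k u) V.
Proof. by rewrite ip_suml; apply: eq_bigr => k _; rewrite ipZl. Qed.

(** Koszul's formula: the tangential part of the connection is metric and torsion-free, so it is
    given by the Christoffel symbols of [g], which [nd] subtracts. *)
Let nd_tangent i j l u : U u -> ip u (nd i j u) (E l u) = 0.
Proof.
move=> Uu.
have D a b c : pd a (fun x => g x b c) u =
    ip u (nab a (E b) u) (E c u) + ip u (nab a (E c) u) (E b u).
  rewrite (ipC _ (E b u) Uu) -nab_metric//; apply: (pd_eq oU) => // x Ux.
  by rewrite ipEE.
rewrite /nd ipDl ipNl sum_ipE.
have -> : \sum_k gam g k i j u * ip u (E k u) (E l u) = \sum_k gam g k i j u * g u k l.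
  by apply: eq_bigr => k _; rewrite -ipEE.
rewrite (gam_lower sg pg)// !D (nabC j i Uu) (nabC l i Uu) (nabC l j Uu).
generalize (ip u (nab i (E j) u) (E l u)), (ip u (nab i (E l) u) (E j u)),
  (ip u (nab j (E l) u) (E i u)) => *.
lra.
Qed.

(** The Gram matrix of the tangent frame and the normal is block diagonal with blocks [g u] and 1,
    hence invertible. This reduces every vector identity below to its products with the frame. *)
Let frame_complete u V : U u -> (forall i, ip u (E i u) V = 0) -> ip u (xi u) V = 0 -> V = 0.
Proof.
move=> Uu EV xV.
pose P : 'M[R]_(m + 1) := col_mx (\matrix_(i < m) E i u) (xi u).
have PK : P *m K u *m P^T = block_mx (g u) 0 0 1%:M.
  rewrite /P mul_col_mx tr_col_mx mul_col_row; congr block_mx.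
  - by apply/matrixP => i j; rewrite mul_bilin !rowK -ipEE.
  - by apply/matrixP => i j; rewrite mul_bilin rowK !ord1 row_id mxE; exact: ipExi.
  - apply/matrixP => i j; rewrite mul_bilin rowK !ord1 row_id mxE.
    by rewrite -/(ip u _ _) ipC//; exact: ipExi.
  - by apply/matrixP => i j; rewrite mul_bilin !ord1 row_id mxE; exact: ipxi.
have uP : P \in unitmx.
  have : P *m K u *m P^T \in unitmx.
    by rewrite PK block_diag_mx_unit unitmx1 andbT; exact/posdef_unitmx/pg.
  by rewrite unitmx_mul => /andP[]; rewrite unitmx_mul => /andP[].
have : P *m K u *m V^T = 0.
  apply/matrixP => a b; rewrite mul_bilin ord1 row_id mxE.
  by case: (split_ordP a) => k ->; rewrite ?rowKu ?rowKd ?rowK ?ord1 ?row_id; [exact: EV|exact: xV].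
move=> /(congr1 (mulmx (invmx (P *m K u)))).
rewrite mulKmx ?unitmx_mul ?uP ?uK// mulmx0 => /(congr1 trmx).
by rewrite trmxK trmx0.
Qed.

Let ndE i j u : U u -> nd i j u = (H u * g u i j) *: xi u.
Proof.
move=> Uu; apply/eqP; rewrite -subr_eq0; apply/eqP; apply: (frame_complete Uu) => [l|].
  by rewrite ipC// ipDl ipNl ipZl nd_tangent// (ipC (xi u))// ipExi// mulr0 subr0.
by rewrite ipC// ipDl ipNl ipZl umbilic// ipxi// mulr1 subrr.
Qed.

Let nabE i j u : U u -> nab i (E j) u =
  (H u * g u i j) *: xi u + \sum_k gam g k i j u *: E k u.
Proof. by move=> Uu; rewrite -ndE// /nd subrK. Qed.

(** Weingarten's formula with shape operator H times the identity: differentiate the orthogonality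
    of [E l] and [xi] for the tangential part, the unit length of [xi] for the normal part. *)
Let nab_xi i u : U u -> nab i xi u = - H u *: E i u.
Proof.
move=> Uu; apply/eqP; rewrite -subr_eq0 scaleNr opprK; apply/eqP.
apply: (frame_complete Uu) => [l|].
  rewrite ipDr ipZr ipEE//.
  have : pd i (fun x => ip x (E l x) (xi x)) u = 0.
    by rewrite (pd_eq oU i (g := fun=> 0)) ?pd_cst// => x Ux; exact: ipExi.
  rewrite nab_metric// nabE// ipDl ipZl ipxi// sum_ipE.
  have -> : \sum_k gam g k i l u * ip u (E k u) (xi u) = 0.
    by rewrite big1// => k _; rewrite ipExi ?mulr0.
  rewrite (metric_coefC sg l i Uu).
  generalize (ip u (E l u) (nab i xi u)) => *. lra.
rewrite ipDr ipZr (ipC _ (E i u) Uu) ipExi// mulr0 addr0.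
have : pd i (fun x => ip x (xi x) (xi x)) u = 0.
  by rewrite (pd_eq oU i (g := fun=> 1)) ?pd_cst// => x Ux; exact: ipxi.
rewrite nab_metric// (ipC (nab i xi u) _ Uu); lra.
Qed.

Variable curv : 'rV[R]_m -> 'rV[R]_(m + 1) -> 'rV[R]_(m + 1) -> 'rV[R]_(m + 1) ->
  'rV[R]_(m + 1).
Variables (c lambda : R).
(** Constant-curvature tensor evaluated on projections to L: subtracting the product of last
    components turns the ambient metric into that of L. *)
Hypothesis curvE : forall u X Y Z W, U u -> ip u (curv u X Y Z) W =
  c * ((ip u Y Z - Y 0 t0 * Z 0 t0) * (ip u X W - X 0 t0 * W 0 t0)
       - (ip u X Z - X 0 t0 * Z 0 t0) * (ip u Y W - Y 0 t0 * W 0 t0)).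
Let tau u := \sum_i \sum_j invmx (g u) i j *: nd i j u.
Hypothesis biharmonic : forall u, U u ->
  \sum_i \sum_j invmx (g u) i j *:
    (nab i (nab j tau) u - \sum_k gam g k i j u *: nab k tau u)
  - \sum_i \sum_j invmx (g u) i j *: curv u (E i u) (tau u) (E j u)
  - lambda *: tau u = 0.
Hypothesis m_gt0 : (0 < m)%N.
Hypothesis lambda_ge0 : 0 <= lambda.

(** Components of the differential of the height function; the function itself is not introduced. *)
Let h i u : R := E i u 0 t0.
Let C u : R := xi u 0 t0.
Let smh i : smooth_on U (h i). Proof. exact: smE. Qed.
Let smC : smooth_on U C. Proof. exact: smxi. Qed.
Let M : R := m%:R.
Let ug u : U u -> g u \in unitmx. Proof. by move=> Uu; exact/posdef_unitmx/pg. Qed.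

Let nab_eq i V W u : (forall x, U x -> V x = W x) -> U u -> nab i V u = nab i W u.
Proof. by move=> VW Uu; rewrite /nab (vpd_eq oU _ VW Uu) VW. Qed.

Let nabD i V W u : vsmooth_on U V -> vsmooth_on U W -> U u ->
  nab i (fun x => V x + W x) u = nab i V u + nab i W u.
Proof.
move=> sV sW Uu; rewrite /nab connD addrACA; congr (_ + _).
apply/rowP => j; rewrite !mxE -(pdD i (sV j) (sW j) Uu).
by apply: (pd_eq oU) => // x _; rewrite mxE.
Qed.

Let nabZ i (a : 'rV[R]_m -> R) V u : smooth_on U a -> vsmooth_on U V -> U u ->
  nab i (fun x => a x *: V x) u = pd i a u *: V u + a u *: nab i V u.
Proof.
move=> sa sV Uu; rewrite /nab connZ scalerDr addrA; congr (_ + _).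
apply/rowP => j; rewrite !mxE.
rewrite (pd_eq oU i (g := fun x => a x * V x 0 j) _ Uu) => [|x _]; last by rewrite mxE.
by rewrite (pdM i sa (sV j) Uu) addrC; congr (_ + _); rewrite mulrC.
Qed.

Let nab_t i V u : U u -> nab i V u 0 t0 = pd i (fun x => V x 0 t0) u.
Proof. by move=> Uu; rewrite /nab mxE conn_t// addr0 mxE. Qed.

(** Last component of the Gauss formula [nabE], with [nab_t] moving the component inside the
    derivative. *)
Let pd_h i j u : U u ->
  pd i (h j) u = H u * g u i j * C u + \sum_k gam g k i j u * h k u.
Proof.
move=> Uu; have := congr1 (fun V : 'rV[R]_(m + 1) => V 0 t0) (nabE i j Uu).
rewrite nab_t// !mxE => ->; congr (_ + _).
by rewrite summxE; apply: eq_bigr => k _; rewrite mxE.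
Qed.

Let pd_C i u : U u -> pd i C u = - H u * h i u.
Proof.
move=> Uu; have := congr1 (fun V : 'rV[R]_(m + 1) => V 0 t0) (nab_xi i Uu).
by rewrite nab_t// !mxE => ->.
Qed.

(** Expand d/dt in the frame and take the last component of the expansion, which is 1. *)
Let unit_split u : U u -> mtrace (g u) (fun i j => h i u * h j u) = 1 - C u ^+ 2.
Proof.
move=> Uu.
(* Tangential coefficients of d/dt: the covector [h] with its index raised. *)
pose a k := \sum_j invmx (g u) k j * h j u.
have Z : basisv t0 - (C u *: xi u + \sum_k a k *: E k u) = 0.
  apply: (frame_complete Uu) => [l|].
    rewrite ipC// ipDl ip_t// ipNl ipDl ipZl sum_ipE (ipC (xi u))// ipExi// mulr0 add0r.
    apply/eqP; rewrite subr_eq0; apply/eqP; rewrite -/(h l u).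
    rewrite -[LHS](mtrace_l (sg Uu) (ug Uu) (h^~ u) l) /mtrace; apply: eq_bigr => k _.
    by rewrite ipEE// /a mulr_suml; apply: eq_bigr => j _; rewrite mulrA.
  rewrite ipC// ipDl ip_t// ipNl ipDl ipZl sum_ipE ipxi// mulr1 big1 ?addr0 ?subrr//.
  by move=> k _; rewrite ipExi// mulr0.
have := congr1 (fun V : 'rV[R]_(m + 1) => V 0 t0) Z.
rewrite !mxE !eqxx summxE /= -/(C u) => Z0.
have -> : mtrace (g u) (fun i j => h i u * h j u) = \sum_k (a k *: E k u) 0 t0.
  apply: eq_bigr => k _; rewrite mxE /a mulr_suml; apply: eq_bigr => j _.
  by rewrite -/(h k u) mulrAC mulrA.
move: (\sum_k (a k *: E k u) 0 t0 : R) (Z0 : 1 - (_ + \sum_k (a k *: E k u) 0 t0) = 0) => s Z1.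
lra.
Qed.

Let tauE u : U u -> tau u = (M * H u) *: xi u.
Proof.
move=> Uu; rewrite /M -(mtrace_metric (sg Uu) (ug Uu)) mulrC /mtrace mulr_sumr scaler_suml.
apply: eq_bigr => i _; rewrite mulr_sumr scaler_suml; apply: eq_bigr => j _.
by rewrite ndE// scalerA; congr (_ *: _); ring.
Qed.

Let sm_pdH i : smooth_on U (pd i H). Proof. exact: smooth_pd. Qed.

Let nab_tau j u : U u ->
  nab j tau u = (M * pd j H u) *: xi u + (- (M * (H u * H u))) *: E j u.
Proof.
move=> Uu; rewrite (nab_eq j tauE Uu).
have sMH : smooth_on U (fun x => M * H x) by apply: smooth_onM => //; exact: smooth_on_cst.
rewrite nabZ// nab_xi// scalerA (pdZ j M smH Uu); congr (_ + _ *: _); ring.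
Qed.

Let hess i j u := pd i (pd j H) u - \sum_k gam g k i j u * pd k H u.

(** The derivative of [nab_tau], with the Christoffel sum from the Gauss formula cancelled by the
    connection correction. The terms in [E i] and [E j] carry the weights 1 and 2 that add up to 3
    after tracing. *)
Let ip_bit i j u W : U u ->
  ip u (nab i (nab j tau) u - \sum_k gam g k i j u *: nab k tau u) W =
  M * (hess i j u * ip u (xi u) W - pd j H u * (H u * ip u (E i u) W)
    - 2 * (pd i H u * (H u * ip u (E j u) W)) - H u ^+ 3 * (g u i j * ip u (xi u) W)).
Proof.
move=> Uu; rewrite (nab_eq i (@nab_tau j) Uu).
have sM : smooth_on U (fun=> M) by exact: smooth_on_cst.
have sHH : smooth_on U (fun x => H x * H x) by exact: smooth_onM.
have s1 : smooth_on U (fun x => M * pd j H x) by exact: smooth_onM.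
have s2 : smooth_on U (fun x => M * (H x * H x)) by exact: smooth_onM.
have s3 : smooth_on U (fun x => - (M * (H x * H x))) by exact: smooth_onN.
rewrite (nabD i (vsmoothZ oU s1 smxi) (vsmoothZ oU s3 (smE j)) Uu).
rewrite !nabZ// nabE// nab_xi// (pdN oU i s2 Uu) (pdZ i M (sm_pdH j) Uu).
rewrite (pdZ i M sHH Uu) (pdM i smH smH Uu).
rewrite !(ipDl, ipNl, ipZl) sum_ipE.
have -> : ip u (\sum_k gam g k i j u *: nab k tau u) W =
   M * (\sum_k gam g k i j u * pd k H u) * ip u (xi u) W
   - M * (H u * H u) * \sum_k gam g k i j u * ip u (E k u) W.
  rewrite ip_suml mulr_sumr mulr_suml mulr_sumr -sumrB.
  apply: eq_bigr => k _; rewrite ipZl nab_tau// ipDl !ipZl; ring.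
rewrite /hess; generalize (\sum_k gam g k i j u * ip u (E k u) W),
  (\sum_k gam g k i j u * pd k H u), (pd i (pd j H) u), (pd i H u), (pd j H u),
  (ip u (xi u) W), (ip u (E i u) W), (ip u (E j u) W) => *.
ring.
Qed.

Let biharmonic_ip u W : U u ->
  mtrace (g u) (fun i j => M * (hess i j u * ip u (xi u) W
    - pd j H u * (H u * ip u (E i u) W)
    - 2 * (pd i H u * (H u * ip u (E j u) W)) - H u ^+ 3 * (g u i j * ip u (xi u) W)))
  - mtrace (g u) (fun i j => ip u (curv u (E i u) (tau u) (E j u)) W)
  = lambda * (M * H u) * ip u (xi u) W.
Proof.
move=> Uu; have := congr1 (fun V => ip u V W) (biharmonic Uu).
rewrite /= ipDl ipNl ipDl ipNl ipZl tauE// ipZl.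
have D (F : 'I_m -> 'I_m -> 'rV[R]_(m + 1)) :
    ip u (\sum_i \sum_j invmx (g u) i j *: F i j) W = mtrace (g u) (fun i j => ip u (F i j) W).
  rewrite ip_suml; apply: eq_bigr => i _; rewrite ip_suml.
  by apply: eq_bigr => j _; rewrite ipZl.
rewrite !D (_ : ip u 0 W = 0) ?/ip ?bilin0l// => /eqP; rewrite subr_eq0 => /eqP.
rewrite -(tauE Uu) (eq_mtrace _ (fun i j => ip_bit i j W Uu)) mulrA => <-.
done.
Qed.

Let M_neq0 : M != 0. Proof. by rewrite pnatr_eq0 -lt0n. Qed.

(** In the curvature term the products of three components of [h] cancel; the two remaining traces
    are m and 1, whence the factor [M - 1]. The common factor [M * H u] is then cancelled. *)
Let eq_tangent l u : U u -> H u != 0 -> 3 * pd l H u = - (c * (M - 1) * (C u * h l u)).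
Proof.
move=> Uu H0; have := biharmonic_ip (E l u) Uu.
rewrite (@eq_mtrace _ _ _ _ (fun i j => - (M * H u) * (pd j H u * g u i l)
    + - (2 * M * H u) * (pd i H u * g u j l))) => [|i j]; last first.
  by rewrite (ipC (xi u))// ipExi// !ipEE//; ring.
rewrite [X in _ - X](@eq_mtrace _ _ _ _ (fun i j => (c * M * H u * C u * h l u) * g u i j
    + - (c * M * H u * C u) * (h j u * g u i l))) => [|i j]; last first.
  rewrite curvE// tauE// !ipZl !(ipC (xi u))// !ipExi// !ipEE// mxE.
  by rewrite -/(h i u) -/(h j u) -/(h l u) -/(C u); ring.
rewrite !mtraceD !mtraceZ (mtrace_l (sg Uu) (ug Uu) (fun j => pd j H u)).
rewrite (mtrace_r (ug Uu) (fun j => pd j H u)) (mtrace_l (sg Uu) (ug Uu) (h^~ u)).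
rewrite (mtrace_metric (sg Uu) (ug Uu)) -/M (ipC (xi u))// ipExi// mulr0.
generalize (pd l H u), (h l u), (C u) => p q r eq0.
have MH : M * H u != 0 by rewrite mulf_neq0.
apply: (mulfI MH); move: eq0; generalize (H u), M => *; lra.
Qed.

Let eq_normal u : U u -> mtrace (g u) (fun i j => hess i j u) - M * H u ^+ 3
  + c * (M - 1) * H u * (1 - C u ^+ 2) = lambda * H u.
Proof.
move=> Uu; have := biharmonic_ip (xi u) Uu.
rewrite (@eq_mtrace _ _ _ _ (fun i j => M * hess i j u + - (M * H u ^+ 3) * g u i j)) => [|i j]; last first.
  by rewrite !ipExi// ipxi//; ring.
rewrite [X in _ - X](@eq_mtrace _ _ _ _ (fun i j => (c * M * H u) * (h i u * h j u)
    + - (c * M * H u * (1 - C u ^+ 2)) * g u i j)) => [|i j]; last first.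
  rewrite curvE// tauE// !ipZl !(ipC (xi u))// !ipExi// !ipEE// ipxi// mxE.
  by rewrite -/(h i u) -/(h j u) -/(C u); ring.
move=> eq0; rewrite !mtraceD !mtraceZ unit_split// (mtrace_metric (sg Uu) (ug Uu)) -/M ipxi// mulr1 in eq0.
move: eq0; generalize (mtrace (g u) (fun i j => hess i j u)) => p eq0.
by apply: (mulfI M_neq0); move: eq0; generalize (H u), (C u), M => *; lra.
Qed.

(** [eq_tangent] holds only where H is nonzero; as this set is open, the equations obtained on it
    may be differentiated. *)
Let N : set 'rV[R]_m := [set u | U u /\ H u != 0].

Let oN : open N.
Proof.
rewrite openE => u [Uu H0].
have cH : {for u, continuous H}.
  by apply: differentiable_continuous; exact: smooth_on_differentiable Uu.
have nH : \forall x \near u, H x != 0 := cvgr_neq0 _ cH H0.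
have nU : \forall x \near u, U x by exact: near_open.
near=> x; split; near: x; [exact: nU|exact: nH].
Unshelve. all: by end_near. Qed.

Let NU u : N u -> U u. Proof. by case. Qed.

Let smN f : smooth_on U f -> smooth_on N f.
Proof. by move=> sf; apply: smooth_onS sf _ => x /NU. Qed.

Let q := c * (M - 1).

Let pd_H l u : N u -> pd l H u = - (q / 3) * (C u * h l u).
Proof. by move=> [Uu H0]; have := eq_tangent l Uu H0; rewrite -/q; lra. Qed.

Let smCh l : smooth_on U (fun x => C x * h l x). Proof. exact: smooth_onM. Qed.

Let pd_Ch i j u : U u -> pd i (fun x => C x * h j x) u =
  C u * (H u * g u i j * C u) + C u * \sum_k gam g k i j u * h k u - H u * (h i u * h j u).
Proof. by move=> Uu; rewrite (pdM i smC (smh j) Uu) pd_h// pd_C//; ring. Qed.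

(** Differentiating [pd_H] produces Christoffel terms from [pd_h], which are exactly those
    subtracted in [hess]. *)
Let hessN i j u : N u -> hess i j u = - (q / 3) * (C u ^+ 2 * H u * g u i j)
  + (q / 3) * (H u * (h i u * h j u)).
Proof.
move=> Nu; have Uu := NU Nu.
rewrite /hess (pd_eq oN i (pd_H j) Nu) (pdZ i _ (smCh j) Uu) pd_Ch//.
have -> : \sum_k gam g k i j u * pd k H u = - (q / 3) * (C u * \sum_k gam g k i j u * h k u).
  by rewrite !mulr_sumr; apply: eq_bigr => k _; rewrite pd_H//; ring.
by generalize (\sum_k gam g k i j u * h k u) => s; ring.
Qed.

(** The traced Hessian contributes (q/3) H (1 - C^2) - (q/3) m H C^2. Added to the curvature term q
    H (1 - C^2) it gives the 4/3 that becomes 4 after multiplying by 3 and dividing by H. *)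
Let first_integral u : N u ->
  4 * q - q * (4 + M) * (C u * C u) - 3 * M * (H u * H u) = 3 * lambda.
Proof.
move=> Nu; have [Uu H0] := Nu; have := eq_normal Uu.
rewrite (@eq_mtrace _ _ _ _ (fun i j => (- (q / 3) * C u ^+ 2 * H u) * g u i j
  + (q / 3 * H u) * (h i u * h j u))) => [|i j]; last by rewrite hessN//; ring.
rewrite mtraceD !mtraceZ unit_split// (mtrace_metric (sg Uu) (ug Uu)) -/M -/q => eq0.
by apply: (mulfI H0); move: eq0; generalize (H u), (C u), M, q => *; lra.
Qed.

Let q_Ch0 l u : N u -> q * (C u * h l u) = 0.
Proof.
move=> Nu; have [Uu H0] := Nu.
have sCC := smN (smooth_onM oU smC smC); have sHH := smN (smooth_onM oU smH smH).
have cstN (a : R) : smooth_on N (fun=> a) by exact: smooth_on_cst.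
have : pd l (fun x => 4 * q - q * (4 + M) * (C x * C x) - 3 * M * (H x * H x)) u = 0.
  by rewrite (pd_eq oN l first_integral Nu) pd_cst.
have s1 := smooth_onM oN (cstN (q * (4 + M))) sCC.
have s2 := smooth_onM oN (cstN (3 * M)) sHH.
rewrite (pdD l (smooth_onD oN (cstN (4 * q)) (smooth_onN oN s1)) (smooth_onN oN s2) Nu).
rewrite (pdD l (cstN (4 * q)) (smooth_onN oN s1) Nu) pd_cst.
rewrite (pdN oN l s1 Nu) (pdN oN l s2 Nu) (pdZ l _ sCC Nu) (pdZ l _ sHH Nu).
rewrite (pdM l smC smC Uu) (pdM l smH smH Uu) pd_C// pd_H// => eq0.
(* The coefficient is 2 (4 + m) + 2 m: the first summand comes from the derivative of C^2, the
   second from that of H^2 through [pd_H]. *)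
have nz : (8 + 4 * M) * H u != 0.
  by rewrite mulf_neq0// lt0r_neq0// ltr_wpDr// mulr_ge0// ler0n.
apply: (mulfI nz); move: eq0; generalize (H u), (C u), (h l u), M, q => *.
lra.
Qed.

Lemma umbilical_biharmonic_minimal u : U u -> H u = 0.
Proof.
move=> Uu; apply/eqP; apply: contraT => H0; have Nu : N u by [].
have M0 : 0 < M by rewrite ltr0n.
have [q0|q0] := eqVneq q 0.
  have := first_integral Nu; rewrite q0 => eq0.
  have : 0 < 3 * M * (H u * H u).
    by rewrite -expr2; apply: mulr_gt0; [exact: mulr_gt0|rewrite exprn_even_gt0].
  by move: eq0 lambda_ge0; generalize (3 * M * (H u * H u)) => *; lra.
have Ch0 l x : N x -> C x * h l x = 0.
  by move=> Nx; apply: (mulfI q0); rewrite q_Ch0// mulr0.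
(* In [pd_Ch] the Christoffel sum carries the factor C and vanishes by [Ch0]; H is a common factor
   of the rest. *)
have hh i j : h i u * h j u = C u ^+ 2 * g u i j.
  have : pd i (fun x => C x * h j x) u = 0.
    by rewrite (pd_eq oN i (Ch0 j) Nu) pd_cst.
  rewrite pd_Ch//.
  have -> : C u * \sum_k gam g k i j u * h k u = 0.
    by rewrite mulr_sumr big1// => k _; rewrite mulrCA Ch0// mulr0.
  move=> eq0; apply: (mulfI H0); move: eq0.
  by generalize (H u), (C u), (g u i j), (h i u * h j u) => *; lra.
(* Positivity of m provides a coordinate vector, whose squared length is a nonzero factor to divide
   out. *)
pose i0 : 'I_m := Ordinal m_gt0.
have gi0 : 0 < g u i0 i0.
  rewrite -(bilin_basis (g u) i0 i0); apply: (pg Uu).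
  apply/eqP => /rowP/(_ i0); rewrite !mxE !eqxx => /eqP; by rewrite oner_eq0.
have C0 : C u = 0.
  have : C u ^+ 3 * g u i0 i0 = 0.
    by rewrite exprS -mulrA -hh mulrA Ch0// mul0r.
  by move/eqP; rewrite mulf_eq0 (gt_eqF gi0) orbF expf_eq0 /= => /eqP.
have := unit_split Uu; rewrite C0 expr0n subr0.
rewrite (@eq_mtrace _ _ _ _ (fun i j => 0 * g u i j)) => [|i j].
  by rewrite mtraceZ mul0r => /esym/eqP; rewrite oner_eq0.
by rewrite hh C0 expr0n.
Qed.

End UmbilicalHypersurface.

(** * The Levi-Civita connection pulled back along a map *)

Section AlongMap.
Context {R : realType} {m n : nat}.
Variable U : set 'rV[R]_m.
Hypothesis oU : open U.
Variable W : set 'rV[R]_n.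
Hypothesis oW : open W.
Variable G : 'rV[R]_n -> 'M[R]_n.
Hypothesis sG : forall y, W y -> (G y)^T = G y.
Hypothesis pG : forall y, W y -> posdef (G y).
Hypothesis smG : forall i j, smooth_on W (fun y => G y i j).
Variable F : 'rV[R]_m -> 'rV[R]_n.
Hypothesis FW : forall u, U u -> W (F u).
Hypothesis smF : vsmooth_on U F.

Lemma smooth_compF f : smooth_on W f -> smooth_on U (fun u => f (F u)).
Proof. by move=> sf; exact: smooth_on_comp oU FW smF sf. Qed.

Lemma pd_comp i f u : smooth_on W f -> U u ->
  pd i (fun x => f (F x)) u = \sum_p vpd i F u 0 p * pd p f (F u).
Proof.
move=> sf Uu; have dF := vsmooth_differentiable smF Uu.
have df := smooth_on_differentiable sf (FW Uu).
rewrite pdE [LHS](derive_comp _ dF df) (derive_basis _ df).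
by apply: eq_bigr => p _; rewrite pdE -(vpdE _ smF Uu).
Qed.

(** Connection matrix in direction i, acting on the right of rows of components; it becomes the
    abstract [conn] of the umbilical computation. *)
Definition conn_mx u i : 'M[R]_n :=
  \matrix_(a, k) \sum_p vpd i F u 0 p * gam G k p a (F u).

Definition nab i (V : 'rV[R]_m -> 'rV[R]_n) u := vpd i V u + V u *m conn_mx u i.

Lemma nabla_alongE i V u : vsmooth_on U V -> U u -> nabla_along G F i V u = nab i V u.
Proof.
move=> sV Uu; rewrite /nabla_along /nab (vpdE i sV Uu) (vpdE i smF Uu); congr (_ + _).
apply/rowP => k; rewrite !mxE exchange_big; apply: eq_bigr => b _.
rewrite mxE mulr_sumr; apply: eq_bigr => a _.
by rewrite -gamE mulrC [X in _ * X]mulrC.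
Qed.

(** The tension field is rewritten in a usable form only on U, yet it has to be differentiated;
    openness of U allows it. *)
Lemma nabla_along_eq i V V' u : (forall x, U x -> V x = V' x) -> U u ->
  nabla_along G F i V u = nabla_along G F i V' u.
Proof.
by move=> VV Uu; rewrite /nabla_along (derive_eq_on _ oU VV Uu) (VV u Uu).
Qed.

Let sm_gam k p a : smooth_on W (gam G k p a). Proof. exact: smooth_gam. Qed.

Lemma smooth_conn_mx i a k : smooth_on U (fun u => conn_mx u i a k).
Proof.
apply: (smooth_on_eq oU (f := fun u => \sum_p vpd i F u 0 p * gam G k p a (F u))).
  by move=> u _; rewrite mxE.
apply: smooth_on_sum => // p; apply: smooth_onM => //; last exact: smooth_compF.
exact: vsmooth_vpd.
Qed.

Lemma vsmooth_nab i V : vsmooth_on U V -> vsmooth_on U (nab i V).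
Proof.
move=> sV; apply: vsmoothD => //; first exact: vsmooth_vpd.
move=> k; apply: (smooth_on_eq oU (f := fun u => \sum_a V u 0 a * conn_mx u i a k)).
  by move=> u _; rewrite mxE.
by apply: smooth_on_sum => // a; apply: smooth_onM => //; exact: smooth_conn_mx.
Qed.

Lemma smooth_bilin V V' : vsmooth_on U V -> vsmooth_on U V' ->
  smooth_on U (fun u => bilin (G (F u)) (V u) (V' u)).
Proof.
move=> sV sV'.
apply: (smooth_on_eq oU (f := fun u => \sum_a \sum_b V u 0 a * G (F u) a b * V' u 0 b)).
  by move=> u _; rewrite bilinE.
apply: smooth_on_sum => // a; apply: smooth_on_sum => // b.
by do 2!(apply: smooth_onM => //); exact: (smooth_compF (smG a b)).
Qed.

(** Pullback of [gam_compat] by the chain rule. *)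
Let compat_mx i u : U u ->
  \matrix_(a, b) pd i (fun x => G (F x) a b) u =
  conn_mx u i *m G (F u) + G (F u) *m (conn_mx u i)^T.
Proof.
move=> Uu; apply/matrixP => a b; rewrite [LHS]mxE (pd_comp i (smG a b) Uu).
transitivity (\sum_p (vpd i F u 0 p * \sum_k gam G k p a (F u) * G (F u) k b
   + vpd i F u 0 p * \sum_k gam G k p b (F u) * G (F u) k a)).
  by apply: eq_bigr => p _; rewrite (gam_compat oW sG pG) ?mulrDr//; exact: FW.
rewrite big_split [RHS]mxE; congr (_ + _).
  rewrite mxE (eq_bigr _ (fun p _ => mulr_sumr _ _ _ _)) exchange_big; apply: eq_bigr => k _.
  by rewrite mxE mulr_suml; apply: eq_bigr => p _; rewrite mulrA.
rewrite mxE (eq_bigr _ (fun p _ => mulr_sumr _ _ _ _)) exchange_big; apply: eq_bigr => k _.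
rewrite !mxE mulr_sumr; apply: eq_bigr => p _.
by rewrite (metric_coefC sG k a (FW Uu)) mulrA mulrC.
Qed.

Let pd_bilin i V V' u : vsmooth_on U V -> vsmooth_on U V' -> U u ->
  pd i (fun x => bilin (G (F x)) (V x) (V' x)) u =
  bilin (G (F u)) (vpd i V u) (V' u) + bilin (G (F u)) (V u) (vpd i V' u)
  + bilin (\matrix_(a, b) pd i (fun x => G (F x) a b) u) (V u) (V' u).
Proof.
move=> sV sV' Uu.
pose T a b x := V x 0 a * G (F x) a b * V' x 0 b.
have sGF a b : smooth_on U (fun x => G (F x) a b) by exact: smooth_compF (smG a b).
have s1 a b : smooth_on U (fun x => V x 0 a * G (F x) a b) by exact: smooth_onM.
have sT a b : smooth_on U (T a b) by exact: smooth_onM.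
rewrite (pd_eq oU i (g := fun x => \sum_a \sum_b T a b x) _ Uu) => [|x _]; last by rewrite bilinE.
have sT1 a : smooth_on U (fun x => \sum_b T a b x) by exact: smooth_on_sum.
rewrite (pd_sum oU i _ sT1 Uu) !bilinE -!big_split; apply: eq_bigr => a _.
rewrite (pd_sum oU i _ (sT a) Uu) -!big_split; apply: eq_bigr => b _.
rewrite /T (pdM i (s1 a b) (sV' b) Uu) (pdM i (sV a) (sGF a b) Uu) !mxE /=.
ring.
Qed.

Lemma nab_metric_compat i V V' u : vsmooth_on U V -> vsmooth_on U V' -> U u ->
  pd i (fun x => bilin (G (F x)) (V x) (V' x)) u =
  bilin (G (F u)) (nab i V u) (V' u) + bilin (G (F u)) (V u) (nab i V' u).
Proof.
move=> sV sV' Uu; rewrite pd_bilin// compat_mx// /nab bilinDl bilinDr [RHS]addrACA.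
congr (_ + _); rewrite /bilin trmx_mul mulmxDr mulmxDl mxE.
by rewrite !mulmxA.
Qed.

(** Absence of torsion: symmetry of second derivatives handles the first summand of [nab], symmetry
    of the Christoffel symbols the second. *)
Lemma nabC i j u : U u -> nab i (vpd j F) u = nab j (vpd i F) u.
Proof.
move=> Uu.
have E1 : vpd i (vpd j F) u = vpd j (vpd i F) u.
  apply/rowP => k; rewrite !mxE.
  rewrite (pd_eq oU i (g := pd j (fun x => F x 0 k)) _ Uu) => [|x _]; last by rewrite mxE.
  rewrite (pdC oU i j (smF k) Uu); apply: (pd_eq oU) => // x _; by rewrite mxE.
have E2 : vpd j F u *m conn_mx u i = vpd i F u *m conn_mx u j.
  apply/rowP => k; rewrite [LHS]mxE [RHS]mxE.
  transitivity (\sum_a \sum_p vpd j F u 0 a * (vpd i F u 0 p * gam G k p a (F u))).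
    by apply: eq_bigr => a _; rewrite [conn_mx u i a k]mxE mulr_sumr.
  rewrite exchange_big; apply: eq_bigr => p _; rewrite [conn_mx u j p k]mxE mulr_sumr.
  by apply: eq_bigr => a _; rewrite (gamC oW sG k p a (FW Uu)) mulrCA.
by rewrite /nab E1 E2.
Qed.

End AlongMap.

(** * From the coordinate definitions to the abstract hypersurface *)

Section LocalHypersurface.
Context {R : realType} {m : nat}.
Variable U : set 'rV[R]_m.
Hypothesis oU : open U.
Variable g : 'rV[R]_m -> 'M[R]_m.
Hypothesis sg : forall u, U u -> (g u)^T = g u.
Hypothesis pg : forall u, U u -> posdef (g u).
Hypothesis smg : forall i j, smooth_on U (fun u => g u i j).
Variable V : set 'rV[R]_m.
Hypothesis oV : open V.
Variable G : 'rV[R]_m -> 'M[R]_m.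
Hypothesis sG : forall y, V y -> (G y)^T = G y.
Hypothesis pG : forall y, V y -> posdef (G y).
Hypothesis smG : forall i j, smooth_on V (fun y => G y i j).
Variable c : R.
Hypothesis curvG : forall y X Y, V y -> free [:: X; Y] -> sectional_curvature G y X Y = c.

Let K (y : 'rV[R]_(m + 1)) : 'M[R]_(m + 1) := block_mx (G (lsubmx y)) 0 0 1%:M.
Let W : set 'rV[R]_(m + 1) := lsubmx @^-1` V.
Hypothesis sK : forall y, W y -> (K y)^T = K y.
Hypothesis pK : forall y, W y -> posdef (K y).
Hypothesis smK : forall i j, smooth_on W (fun y => K y i j).

Variables (F N : 'rV[R]_m -> 'rV[R]_(m + 1)).
Hypothesis FW : forall u, U u -> W (F u).
Hypothesis smF : vsmooth_on U F.
Hypothesis smN : vsmooth_on U N.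
Hypothesis isometric : forall u v w, U u ->
  bilin (g u) v w = bilin (K (F u)) ('D_v F u) ('D_w F u).
Hypothesis unitN : forall u, U u -> bilin (K (F u)) (N u) (N u) = 1.
Hypothesis normalN : forall u v, U u -> bilin (K (F u)) ('D_v F u) (N u) = 0.

Let sff u : 'M[R]_m := \matrix_(i, j) bilin (K (F u)) (nabla_d g K F i j u) (N u).
Let H u : R := m%:R^-1 * \tr (sff u *m invmx (g u)).

Hypothesis umbilical : forall u X Y, U u -> bilin (sff u) X Y = H u * bilin (g u) X Y.
Variable lambda : R.
Hypothesis biharmonic : forall u, U u ->
  bitension g K F u - lambda *: tension g K F u = 0.
Hypothesis m_gt0 : (0 < m)%N.
Hypothesis lambda_ge0 : 0 <= lambda.

Let oW : open W.
Proof. by apply: open_comp => // ? _; exact: continuous_lsubmx. Qed.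

Let E i := vpd i F.

Let smE i : vsmooth_on U (E i). Proof. exact: vsmooth_vpd. Qed.

Let DF i u : U u -> 'D_(basisv i) F u = E i u. Proof. exact: vpdE. Qed.

Let nd i j u := nab K F i (E j) u - \sum_k gam g k i j u *: E k u.

Let nabla_dE i j u : U u -> nabla_d g K F i j u = nd i j u.
Proof.
move=> Uu; rewrite /nabla_d /nd (nabla_along_eq oU _ _ _ (@DF j) Uu) (nabla_alongE _ smF i (smE j) Uu).
by congr (_ - _); apply: eq_bigr => k _; rewrite gamE DF.
Qed.

Let smgam k i j : smooth_on U (gam g k i j). Proof. exact: smooth_gam. Qed.

Let smnab i X : vsmooth_on U X -> vsmooth_on U (nab K F i X).
Proof. exact: (vsmooth_nab oU oW pK smK FW smF). Qed.

Let smnd i j : vsmooth_on U (nd i j).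
Proof.
have s1 : vsmooth_on U (fun u => \sum_k gam g k i j u *: E k u).
  by apply: vsmooth_sum => // k; exact: vsmoothZ.
have s2 : vsmooth_on U (fun u => - 1 *: \sum_k gam g k i j u *: E k u).
  by apply: vsmoothZ => //; exact: smooth_on_cst.
apply: vsmooth_eq (vsmoothD oU (smnab i (smE j)) s2) => // u _.
by rewrite /nd scaleN1r.
Qed.

Let sminv i j : smooth_on U (fun u => invmx (g u) i j).
Proof. by apply: smooth_on_invmx => // u Uu; exact/posdef_unitmx/pg. Qed.

(** The core argument takes second derivatives of H, so smoothness has to be extracted from its
    formula as a trace. *)
Let smH : smooth_on U H.
Proof.
apply: smooth_onM => //; first exact: smooth_on_cst.
apply: (smooth_on_eq oU (f := fun u =>
   \sum_i \sum_j bilin (K (F u)) (nd i j u) (N u) * invmx (g u) j i)).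
  move=> u Uu; apply: eq_bigr => i _; rewrite mxE; apply: eq_bigr => j _.
  by rewrite mxE nabla_dE.
apply: smooth_on_sum => // i; apply: smooth_on_sum => // j; apply: smooth_onM => //.
exact: (smooth_bilin oU smK FW smF).
Qed.

Let tau u := \sum_i \sum_j invmx (g u) i j *: nd i j u.

Let tensionE u : U u -> tension g K F u = tau u.
Proof.
move=> Uu; do 2!(apply: eq_bigr => ? _); by rewrite nabla_dE.
Qed.

Let smtau : vsmooth_on U tau.
Proof.
by apply: vsmooth_sum => // i; apply: vsmooth_sum => // j; exact: vsmoothZ.
Qed.

Let nabla_tau j u : U u -> nabla_along K F j (tension g K F) u = nab K F j tau u.
Proof.
by move=> Uu; rewrite (nabla_along_eq oU _ _ _ tensionE Uu) (nabla_alongE _ smF j smtau Uu).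
Qed.

Let nabla2_tau i j u : U u ->
  nabla_along K F i (nabla_along K F j (tension g K F)) u = nab K F i (nab K F j tau) u.
Proof.
move=> Uu; rewrite (nabla_along_eq oU _ _ _ (@nabla_tau j) Uu).
by rewrite (nabla_alongE _ smF i (smnab j smtau) Uu).
Qed.

Let bitensionE u : U u -> bitension g K F u =
  \sum_i \sum_j invmx (g u) i j *:
    (nab K F i (nab K F j tau) u - \sum_k gam g k i j u *: nab K F k tau u)
  - \sum_i \sum_j invmx (g u) i j *: curvature K (F u) (E i u) (tau u) (E j u).
Proof.
move=> Uu; rewrite /bitension; congr (_ - _).
  apply: eq_bigr => i _; apply: eq_bigr => j _; rewrite nabla2_tau//.
  by congr (_ *: (_ - _)); apply: eq_bigr => k _; rewrite gamE nabla_tau.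
apply: eq_bigr => i _; apply: eq_bigr => j _.
by rewrite tensionE// !DF.
Qed.

Let ip_t y X : bilin (K y) (basisv (rshift m 0)) X = X 0 (rshift m 0).
Proof.
have l0 : lsubmx (basisv (rshift m 0) : 'rV[R]_(m + 1)) = 0.
  by apply/rowP => j; rewrite !mxE eq_lrshift.
by rewrite bilin_prod l0 bilin0l add0r mxE !eqxx mul1r.
Qed.

Lemma local_hypersurface_minimal u : U u -> H u = 0.
Proof.
apply: (@umbilical_biharmonic_minimal _ _ _ oU g sg pg (fun u => K (F u)) _ _ E N smE smN
  (fun u i X => X *m conn_mx K F u i) _ _ _ _ _ _ _ _ _ H smH _
  (fun u => curvature K (F u)) c lambda _ _ m_gt0 lambda_ge0).
- by move=> x Ux; exact/sK/FW.
- by move=> x Ux; exact/posdef_unitmx/pK/FW.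
- by move=> x i X Y; exact: mulmxDl.
- by move=> x i a X; rewrite -scalemxAl.
- by move=> i j x Ux; exact: (nabC oU oW sK FW smF).
- by move=> i X Y x sX sY Ux; exact: (nab_metric_compat oU oW sK pK smK FW smF).
- by move=> x X Ux; exact: ip_t.
(* Parallelism of d/dt: Christoffel symbols with upper index in the line factor vanish. *)
- move=> x i X Ux; rewrite mxE big1// => a _.
  rewrite mxE big1 ?mulr0// => p _.
  by rewrite (gam_prod_r1 pG) ?mulr0//; exact: FW.
- by move=> x i j Ux; rewrite -!DF// -isometric// bilin_basis.
- by move=> x i Ux; rewrite -DF// normalN.
- exact: unitN.
- move=> i j x Ux; rewrite -[g x i j]bilin_basis -umbilical// bilin_basis mxE.
  by rewrite nabla_dE.
(* The curvature vector has no line component; [addrK] then identifies the metric of L with the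
   ambient one minus the product of last components. *)
- move=> x X Y Z T Ux; have Wx := FW Ux.
  rewrite (curvature_prod oV pG _ _ _ Wx).
  rewrite !bilin_prod row_mxKl row_mxEr [X in _ + X * _]mxE mul0r addr0.
  rewrite (constant_curvature_tensor oV sG pG smG Wx (fun X Y => @curvG _ X Y Wx)).
  by rewrite !addrK.
- by move=> x Ux; have := biharmonic Ux; rewrite bitensionE// tensionE.
Qed.

End LocalHypersurface.

(** Minimality is a pointwise statement in a pair of charts, so it reduces to the local result on
    the domain of the coordinate representation of [phi]. *)
Theorem theorem5p3 (R : realType) (m : nat) (c lambda : R)
    (L M : riemannian R m)
    (phi : M -> riemannian_prod L (@real_line R))
    (xi : atlas (riemannian_prod L (@real_line R)) -> M -> 'rV[R]_(m + 1)) :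
  (0 < m)%N ->
  c = 1 \/ c = -1 \/ c = 0 ->
  space_form c L ->
  0 <= lambda ->
  isometric_immersion phi ->
  unit_normal_field phi xi ->
  lambda_biharmonic phi lambda ->
  totally_umbilical phi xi ->
  minimal phi xi.
Proof.
move=> m0 _ [_ _ cL] l0 [[cphi sphi] iso] [[_ sxi] nxi] [_ bih] umb a b u Uu.
pose U := local_dom phi (mchart a) (mchart b).
(* Continuity of [phi] makes this domain open, as differentiating on it requires. *)
have oU : open U.
  rewrite openE => x [ax bx].
  have ci := chart_inv_continuous ax.
  have cp : {for x, continuous (phi \o chart_inv (mchart a))}.
    by apply: continuous_comp => //; exact: cphi.
  have n1 : \forall y \near x, chart_cod (mchart a) y.
    by apply: open_nbhs_nbhs; split => //; exact: chart_cod_open.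
  have n2 : \forall y \near x, chart_dom (mchart b) (phi (chart_inv (mchart a) y)).
    by apply: cp; apply: open_nbhs_nbhs; split => //; exact: chart_dom_open.
  near=> y; split; near: y; [exact: n1|exact: n2].
refine (@local_hypersurface_minimal R m U oU (metric a) _ _ _
  (chart_cod (mchart b.1)) (@chart_cod_open _ _ _ (mchart b.1)) (metric b.1) _ _ _ c _ _ _ _
  (local_rep phi (mchart a) (mchart b)) (fun x => xi b (chart_inv (mchart a) x))
  _ _ _ _ _ _ _ lambda _ m0 l0 u Uu).
- by move=> x [ax _]; exact: (@Defs.metric_sym _ _ M a x ax).
- by move=> x [ax _]; exact: (@metric_posdef _ _ M a x ax).
- by move=> i j; apply: smooth_onS (@metric_smooth _ _ M a i j) _ => x [].
- by move=> y Vy; exact: (@Defs.metric_sym _ _ L b.1 y Vy).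
- by move=> y Vy; exact: (@metric_posdef _ _ L b.1 y Vy).
- by move=> i j; exact: (@metric_smooth _ _ L b.1 i j).
- by move=> y X Y Vy; exact: cL.
(* The line chart covers all of R, so lying in the image of the product chart [b] is a condition on
   the L coordinates alone; [I] fills the other half. *)
- by move=> y Wy; exact: (@Defs.metric_sym _ _ (riemannian_prod L (@real_line R)) b y (conj Wy I)).
- by move=> y Wy; exact: (@metric_posdef _ _ (riemannian_prod L (@real_line R)) b y (conj Wy I)).
- move=> i j; apply: smooth_onS (@metric_smooth _ _ (riemannian_prod L (@real_line R)) b i j) _.
  by move=> y Wy; split.
- by move=> x [_ bx]; have [] := chart_funS bx.
- by move=> j; exact: sphi.
- by move=> j; exact: sxi.
- by move=> x v w Ux; exact: iso.
- by move=> x Ux; have [] := nxi a b x Ux.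
- by move=> x v Ux; have [_] := nxi a b x Ux.
- by move=> x X Y Ux; exact: umb.
- by move=> x Ux; exact: bih.
Unshelve. all: by end_near. Qed.
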